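(* Let $p$ be an odd prime and let $H,N$ be integers with $0\le H<H+N<p$. Let $d\ge 0$ be a fixed integer. For a multiplicative character $\chi$ of $\mathbb{F}_p^*$ and a polynomial $f\in\mathbb{F}_p[X]$ define $$T(\chi,f,H,N)=\sum_{n=H+1}^{H+N}\chi(n!)\,\mathbf{e}(f(n)).$$ Then $$\max_{\deg f=d}\ \max_{\chi\neq\chi_0}|T(\chi,f,H,N)|\ll N^{3/4}p^{1/8}(\log p)^{1/4},$$ where the first maximum is over all $f\in\mathbb{F}_p[X]$ of degree $d$ and the second over all nonprincipal multiplicative characters $\chi$ of $\mathbb{F}_p^*$.
   Context: $\mathbb{F}_p$ is represented by $\{0,1,\dots,p-1\}$, and $\mathbf{e}(z)=\exp(2\pi i z/p)$ (an additive character of $\mathbb{F}_p$). $\chi_0$ denotes the principal character. Since $n<p$, $n!\not\equiv 0\pmod p$, so $\chi(n!)$ is defined. The implied constant in $\ll$ may depend on $d$ but not on $p,H,N$. *)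

(* Defs.v *)
From HB Require Import structures.
From mathcomp Require Import all_boot all_order all_algebra all_fingroup.
From mathcomp Require Import all_classical all_reals all_analysis.
From mathcomp Require Import complex.

Set Implicit Arguments.
Unset Strict Implicit.
Unset Printing Implicit Defensive.

Import Order.TTheory GRing.Theory Num.Theory.

Local Open Scope ring_scope.
Local Open Scope complex_scope.

(* All definitions are meant for p prime: 'F_p is then the field with p
   elements, with carrier the ordinals {0, ..., p - 1}. *)

(* e(z) = exp(2 pi i z / p), z being read through its representative in
   {0, ..., p - 1}. *)
Definition add_char (R : realType) (p : nat) (z : 'F_p) : R[i] :=
  let t : R := 2 * pi * (nat_of_ord z)%:R / p%:R in cos t +i* sin t.

(* Values are automatically nonzero, so this is a group homomorphism from
   F_p^* to C^*. *)
Definition mult_char (R : realType) (p : nat) (chi : {unit 'F_p} -> R[i]) : Prop :=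
  chi 1%g = 1 /\ forall x y : {unit 'F_p}, chi (x * y)%g = chi x * chi y.

Definition principal_char (R : realType) (p : nat) : {unit 'F_p} -> R[i] :=
  fun=> 1.

(* n! as an element of F_p^*; the default value 1%g is never used when n < p,
   see val_unit_fact. *)
Definition unit_fact (p n : nat) : {unit 'F_p} := insubd (1%g : {unit 'F_p}) (n`!%:R : 'F_p).

Lemma val_unit_fact (p n : nat) : prime p -> (n < p)%N ->
  val (unit_fact p n) = n`!%:R :> 'F_p.
Proof.
move=> p_pr ltnp; rewrite /unit_fact insubdK // unfold_in /= ?unitfE.
have fact0 m : (m < p)%N -> m`!%:R != 0 :> 'F_p.
  elim: m => [|m IHm] ltmp; first by rewrite fact0 oner_neq0.
  rewrite factS natrM mulf_neq0 ?IHm 1?ltnW //.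
  by rewrite -(dvdn_pcharf (pchar_Fp p_pr)) gtnNdvd.
exact: fact0.
Qed.

Definition fact_sum (R : realType) (p : nat) (chi : {unit 'F_p} -> R[i])
    (f : {poly 'F_p}) (H N : nat) : R[i] :=
  \sum_(H.+1 <= n < (H + N).+1) chi (unit_fact p n) * add_char R f.[n%:R].

(* Main.v *)
Require Import Defs.
From HB Require Import structures.
From mathcomp Require Import all_boot all_order all_algebra all_fingroup all_field.
From mathcomp Require Import all_classical all_reals all_analysis.
From mathcomp Require Import complex.
From mathcomp Require Import zify ring lra.

Set Implicit Arguments.
Unset Strict Implicit.
Unset Printing Implicit Defensive.

Import Order.TTheory GRing.Theory Num.Theory.

Local Open Scope ring_scope.
Local Open Scope complex_scope.

(* Shifting n by k < K and applying Cauchy-Schwarz (van der Corput) replaces n! by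
   quotients (n + k)! / n!, that is, reduces the sum to incomplete sums of
   chi((n + 1) ... (n + j)) e(f(n + j) - f(n)).  Completing these costs a factor
   log p and leads to the Weil bound (K + d) sqrt p for the complete sums of
   chi(x (x + 1) ... (x + K - 1)) e(g(x)); the result follows with
   K^2 ~ N / (sqrt p log p).

   Weil's bound is proved elementarily.  The character sum is, up to sign, the
   linear coefficient of an L-function which is a polynomial of degree < K + d, and
   its inverse roots w_i satisfy S_v = - sum_i w_i^v, where S_v is the analogous sum
   over the field with p^v elements.  Hence |w_i| <= sqrt p as soon as S_(2m) = O(p^m).
   To get this, partition the field with Q^2 elements, Q = p^m, according to the norm
   of h(x) = prod_i (- i - x) and the trace of g(x): each of the (p - 1) p classes
   should have about Q^2 / ((p - 1) p) elements, and since the classes add up to the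
   whole field only an upper bound for each of them is needed.  That bound comes from
   the Stepanov-Bombieri method: with H = h^((Q - 1)/(p - 1)) and
   T = g + g^p + ... + g^(Q/p), a nonzero combination w of the polynomials
   X^(a + Q a') H^b T^c with a, b, c small is made to vanish on the whole class, the
   Q-th power of w agreeing there with a polynomial of low degree. *)

(** * Stepanov's method *)

(** The heart of Stepanov's method is that the auxiliary polynomial w is not zero, and this is read
    off X-adic valuations. The factor i = 0 of h is - X, so H has valuation exactly e = (Q - 1)/(p -
    1), and the powers H^b, b < p - 1, are told apart modulo Q. For T, the identity T^p - T = g^Q -
    g makes T, modulo X^Q, a root of an Artin-Schreier polynomial of low degree in X; it has no
    proper factor because p does not divide deg g, so a short combination of the X^a T^c cannot
    vanish to order e. The field has Q^2 elements because Q-th powers are then cheap on a class: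
    x^(Q^2) = x, while the norm and trace conditions give H^Q = u / H and T^Q = t - T. The class
    bounds are wasteful in p, K and g. This is harmless: only the growth of S_(2m) in m matters, and
    passing to the inverse roots w_i removes every constant. The remaining cases need no Weil bound:
    if p <= d + 1, or if N is below about sqrt p log p, the trivial bound N suffices. *)

Section ArtinSchreier.
Variables (F : fieldType) (p d : nat).
Hypotheses (p_pr : prime p) (d_gt0 : (0 < d)%N) (cop : coprime p d).

Definition AS_poly (g : {poly F}) : {poly {poly F}} := 'X^p - 'X + g%:P.

Lemma size_AS_poly (g : {poly F}) : size (AS_poly g) = p.+1.
Proof.
have p1 := prime_gt1 p_pr.
rewrite /AS_poly -addrA size_polyDl size_polyXn //.
rewrite ltnS (leq_trans (size_polyD _ _)) // size_polyN size_polyX geq_max p1 /=.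
by rewrite size_polyC; case: (g != 0) => //=; apply: ltnW.
Qed.

(* Giving x weight p and Z weight d makes the monomials x^i Z^j, j < p, have
   distinct weights; wgt_eval restricts to a curve on which no cancellation
   between them can occur. *)
Definition wgt_eval (th : F) (A : {poly {poly F}}) : {poly F} :=
  (map_poly (comp_poly 'X^p) A).[th *: 'X^d].

Lemma wgt_evalM (th : F) (A B : {poly {poly F}}) : wgt_eval th (A * B) = wgt_eval th A * wgt_eval th B.
Proof. by rewrite /wgt_eval rmorphM hornerM. Qed.

(** Only the top power of Z contributes to the coefficient of exponent [N]: the term of Z^i has
    exponents congruent to d i modulo p, and these residues are distinct for i < p because d is
    prime to p. *)
Lemma size_wgt_eval (th : F) (A : {poly {poly F}}) : th != 0 -> A != 0 -> (size A <= p)%N ->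
  (p * (size (lead_coef A)).-1 + d * (size A).-1 < size (wgt_eval th A))%N.
Proof.
move=> th0 A0 sA; have p0 := prime_gt0 p_pr.
set N := (_ + _)%N.
suff: (wgt_eval th A)`_N != 0 by apply: contraR; rewrite -leqNgt => /leq_sizeP ->.
have inj : injective (comp_poly ('X^p : {poly F})).
  apply: raddf_inj => q /eqP; rewrite comp_poly_eq0 ?size_polyXn ?ltnS //.
  by move/eqP.
rewrite /wgt_eval horner_coef size_map_inj_poly ?comp_poly0 // coef_sum.
have sA0 : (0 < size A)%N by rewrite size_poly_gt0.
have lt : ((size A).-1 < size A)%N by rewrite prednK.
have cE (i : 'I_(size A)) :
    ((map_poly (comp_poly 'X^p) A)`_i * (th *: 'X^d) ^+ i)`_N =
    th ^+ i * (if (N < d * i)%N then 0 else (A`_i \Po 'X^p)`_(N - d * i)).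
  rewrite coef_map exprZn -scalerAr coefZ -exprM coefMXn.
  by [].
under eq_bigr do rewrite cE.
rewrite (bigD1 (Ordinal lt)) //= big1 => [|i ne].
  rewrite addr0 mulf_neq0 ?expf_neq0 // ltnNge leq_addl /= addnK.
  rewrite coef_comp_poly_Xn // dvdn_mulr // mulKn //.
  by rewrite -[X in X != 0]/(lead_coef (lead_coef A)) !lead_coef_eq0.
case: ltnP => le; first by rewrite mulr0.
rewrite coef_comp_poly_Xn //; case: ifP; rewrite ?mulr0 // => dv.
case/negP: ne; apply/eqP/val_inj => /=.
have hi : (i <= (size A).-1)%N by rewrite -ltnS prednK.
have: (p %| d * ((size A).-1 - i))%N.
  move: dv. have -> : (N - d * i = p * (size (lead_coef A)).-1 + d * ((size A).-1 - i))%N.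
    have hia : (d * i <= d * (size A).-1)%N by rewrite leq_mul2l hi orbT.
    by rewrite /N mulnBr addnBA.
  by rewrite dvdn_addr // dvdn_mulr.
rewrite Gauss_dvdr // => /dvdnP[k].
set a := (size A).-1 in hi *; have : (a < p)%N by rewrite /a prednK.
by case: k => [|k]; rewrite ?mulSn; lia.
Qed.

(** Since th^p = - lead_coef g, the top terms of Z^p and g cancel on the curve of [wgt_eval], and
    the image of [AS_poly g] has degree below d p. Factors of Z-degree below p cannot lose degree
    this way, and their images have total degree at least p deg c + d p, a contradiction. The scalar
    c comes from pseudo-division in F[X][Z]. *)
Lemma AS_poly_irred (g : {poly F}) (c : {poly F}) (A D : {poly {poly F}}) (th : F) :
  size g = d.+1 -> th ^+ p = - lead_coef g -> c != 0 ->
  c *: AS_poly g = A * D -> (1 < size D <= p)%N -> False.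
Proof.
move=> sg thp c0 E /andP[D1 Dp].
have p0 := prime_gt0 p_pr; have p1 := prime_gt1 p_pr.
have th0 : th != 0.
  apply/eqP => th0; move: thp; rewrite th0 expr0n gtn_eqF //= => /eqP.
  by rewrite eq_sym oppr_eq0 lead_coef_eq0 -size_poly_eq0 sg.
have AS0 : AS_poly g != 0 by rewrite -size_poly_eq0 size_AS_poly.
have D0 : D != 0 by rewrite -size_poly_gt0; lia.
have cAS0 : c *: AS_poly g != 0 by rewrite -mul_polyC mulf_neq0 ?polyC_eq0.
have A0 : A != 0 by apply: contraNneq cAS0 => A0; rewrite E A0 mul0r.
have sAD : (size A + size D).-1 = p.+1.
  by rewrite -size_mul // -E -mul_polyC size_mul ?polyC_eq0 // size_polyC c0 size_AS_poly.
have lcAS : lead_coef (AS_poly g) = 1.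
  by rewrite lead_coefE size_AS_poly /= !coefD coefN coefXn eqxx coefX coefC gtn_eqF // gtn_eqF // subr0 addr0.
have lc : lead_coef A * lead_coef D = c.
  by rewrite -lead_coefM -E -mul_polyC lead_coefM lead_coefC lcAS mulr1.
have sc : (size (lead_coef A) + size (lead_coef D)).-1 = size c.
  by rewrite -lc size_mul // lead_coef_eq0.
have wE : wgt_eval th (c *: AS_poly g) = (c \Po 'X^p) * wgt_eval th (AS_poly g).
  by rewrite -mul_polyC wgt_evalM /wgt_eval map_polyC hornerC.
have wAS : (size (wgt_eval th (AS_poly g)) <= d * p)%N.
  rewrite /wgt_eval /AS_poly !rmorphD rmorphN /= map_polyXn map_polyX map_polyC /=.
  rewrite !hornerE exprZn -exprM.
  apply/leq_sizeP => j jge; rewrite !coefD coefN !coefZ !coefXn coef_comp_poly_Xn //.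
  have -> : (j == d) = false by apply/eqP; nia.
  rewrite mulr0 subr0; case: (j =P (d * p)%N) => [->|ne] /=.
    by rewrite dvdn_mull // mulnK // mulr1 thp lead_coefE sg /= addNr.
  rewrite mulr0 add0r; case: ifP => // dv; rewrite nth_default // sg.
  by rewrite ltn_divRL //; lia.
have := size_wgt_eval th0 A0 _; have := size_wgt_eval th0 D0 Dp.
have sA : (size A <= p)%N.
  move: sAD D1. move: (size A) (size D) => a b; lia.
move=> hD /(_ sA) hA.
have wA0 : wgt_eval th A != 0 by rewrite -size_poly_gt0 (leq_ltn_trans _ hA).
have wD0 : wgt_eval th D != 0 by rewrite -size_poly_gt0 (leq_ltn_trans _ hD).
have: size (wgt_eval th (c *: AS_poly g)) = (size (wgt_eval th A) + size (wgt_eval th D)).-1.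
  by rewrite E wgt_evalM size_mul.
rewrite wE => szE.
have := size_polyMleq (c \Po 'X^p) (wgt_eval th (AS_poly g)); rewrite szE.
have : (size (c \Po 'X^p) <= p * (size c).-1 + 1)%N.
  by rewrite (leq_trans (size_comp_poly_leq _ _)) // size_polyXn /= mulnC addn1.
have lA : (0 < size (lead_coef A))%N by rewrite size_poly_gt0 lead_coef_eq0.
have lD : (0 < size (lead_coef D))%N by rewrite size_poly_gt0 lead_coef_eq0.
move: sc hA hD sAD lA lD szE D1 Dp; rewrite -!size_poly_gt0 in A0 wA0 wD0.
move: A0 wA0 wD0.
move: (size c) (size (lead_coef A)) (size (lead_coef D)) (size A) (size D).
move: (size (wgt_eval th A)) (size (wgt_eval th D)) => wA wD c1 la ld a b.
move=> *; nia.
Qed.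

End ArtinSchreier.

Lemma size_det_leq (R : comNzRingType) (n B : nat) (M : 'M[{poly R}]_n) :
  (forall i j, size (M i j) <= B.+1)%N -> (size (\det M) <= n * B + 1)%N.
Proof.
move=> sM; rewrite /determinant (leq_trans (size_sum _ _ _)) //.
apply/bigmax_leqP => s _; rewrite size_Msign.
rewrite (leq_trans (size_poly_prod_leq _ _)) // leq_subLR cardT size_enum_ord.
have : (\sum_(i < n) size (M i (s i)) <= \sum_(i < n) B.+1)%N by apply: leq_sum.
by rewrite sum_nat_const card_ord mulnS addn1 addnS ltnS.
Qed.

(* T is a root of the Artin-Schreier polynomial modulo 'X^m; eliminating Z between it
   and A by a resultant gives a nonzero polynomial of degree at most 2 p B. *)
Lemma horner_AS_not_dvd (F : fieldType) (p d B m : nat) (g T : {poly F}) (th : F)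
    (A : {poly {poly F}}) :
  prime p -> coprime p d -> (0 < d <= B)%N -> size g = d.+1 ->
  th ^+ p = - lead_coef g -> 'X^m %| T ^+ p - T + g ->
  A != 0 -> (size A <= p)%N -> (forall i, size (A`_i)%R <= B.+1)%N ->
  (2 * p * B < m)%N -> ~~ ('X^m %| A.[T]).
Proof.
move=> p_pr cop /andP[d0 dB] sg thp dvT A0 sA sAi Bm; apply/negP => dvA.
have p1 := prime_gt1 p_pr; have p0 := prime_gt0 p_pr.
have small (q : {poly F}) : q != 0 -> 'X^m %| q -> (m < size q)%N.
  by move=> q0 dv; have := dvdp_leq q0 dv; rewrite size_polyXn.
have [sA1|sA1] := leqP (size A) 1.
  move: dvA A0 (sAi 0%N); rewrite (size1_polyC sA1) hornerC coefC /= polyC_eq0.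
  by move=> dv q0 /(leq_trans (small _ q0 dv)); nia.
pose S := AS_poly p g.
have sS : size S = p.+1 by apply: size_AS_poly.
have S0 : S != 0 by rewrite -size_poly_eq0 sS.
have sS1 : (1 < size S)%N by rewrite sS.
have sSi i : (size (S`_i)%R <= B.+1)%N.
  rewrite /S /AS_poly !coefD coefN coefXn coefX coefC.
  rewrite (leq_trans (size_polyD _ _)) // geq_max; apply/andP; split.
    rewrite (leq_trans (size_polyD _ _)) // geq_max size_polyN.
    by do 2!case: (_ == _); rewrite ?size_poly0 ?size_poly1.
  by case: eqP => _; rewrite ?size_poly0 // sg.
have szr : (size (resultant A S) <= (p + p) * B + 1)%N.
  rewrite (leq_trans (size_det_leq (B := B) _)) //.
    move=> i j; rewrite Sylvester_mxE; case: (fintype.split i) => k;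
    case: (k <= j)%N; rewrite ?mulr1n ?mulr0n ?size_poly0 ?sAi ?sSi //.
by rewrite leq_add2r leq_mul2r sS; apply/orP; right; move: (size A) sA => a; lia.
(* The resultant lies in the ideal of A and S, so substituting T for Z makes it a multiple of 'X^m;
   its degree is too small for that unless it is 0. Then A and S share a factor of Z-degree between
   1 and p - 1. *)
have r0 : resultant A S == 0.
  apply: contraTT isT => r0; have [uv _ E] := resultant_in_ideal sA1 sS1.
  have : 'X^m %| resultant A S.
    have := congr1 (fun q : {poly {poly F}} => q.[T]) E.
    rewrite hornerC hornerD !hornerM => ->.
    rewrite dvdp_add ?dvdp_mull // /S /AS_poly !hornerE.
    by rewrite ?hornerXn.
  by move/(small _ r0)/leq_trans/(_ szr); nia.
move: r0; rewrite resultant_eq0; set D := gcdp A S => D1.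
have DA : (size D <= size A)%N by rewrite dvdp_leq // dvdp_gcdl.
have /Pdiv.Idomain.dvdpP[[c q] /= c0 E] : D %| S by apply: dvdp_gcdr.
apply: (@AS_poly_irred F p d p_pr d0 cop g c q D th) => //.
by rewrite D1 (leq_trans DA).
Qed.

(** * Independence of the auxiliary monomials through X-adic valuations *)

Section Independence.
Variable F : fieldType.

Lemma poly_lowest_term (q : {poly F}) : q != 0 ->
  exists v, exists2 U, q = 'X^v * U & U.[0] != 0.
Proof.
move=> q0; have [v [U]] := multiplicity_XsubC q 0.
rewrite q0 /= => nr E; exists v, U => //.
by rewrite E subr0 mulrC.
Qed.

Lemma sum_distinct_order_neq0 (I : finType) (f U : I -> {poly F}) (n : I -> nat) (P : pred I) i0 :
  P i0 -> (forall i, P i -> f i = 'X^(n i) * U i /\ (U i).[0] != 0) ->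
  {in P &, injective n} -> \sum_(i | P i) f i != 0.
Proof.
move=> Pi0 fE inj; case: (arg_minnP n Pi0) => j Pj jmin.
apply: contraTneq isT => s0.
have : (\sum_(i | P i) f i)`_(n j) != 0.
  rewrite coef_sum (bigD1 j) //= big1 ?addr0 => [|i /andP[Pi ij]].
    by have [-> U0] := fE j Pj; rewrite coefXnM ltnn subnn -horner_coef0.
  have [-> _] := fE i Pi; rewrite coefXnM ifT // ltn_neqAle jmin // andbT.
  by apply: contra_neq ij => /inj ->.
by rewrite s0 coef0 eqxx.
Qed.

(* The X-adic valuation of a combination of the c i with coefficients in
   F[X^Q] lies in Q N + [0, M) as soon as nonzero constant combinations have
   valuation < M. *)
Lemma frobenius_comb_order (I : finType) (c E : I -> {poly F}) (Q M : nat) :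
  (0 < Q)%N -> (M <= Q)%N ->
  (forall a : I -> F, (exists i, a i != 0) -> ~~ ('X^M %| \sum_i a i *: c i)) ->
  (exists i, E i != 0) ->
  exists j v U, [/\ \sum_i c i * (E i \Po 'X^Q) = 'X^(Q * j + v) * U, (v < M)%N & U.[0] != 0].
Proof.
move=> Q0 MQ ind.
have [n] := ubnP (\sum_i size (E i)); elim: n E => // n IHn E ltEn [i0 Ei0].
(* Modulo 'X^M only the constant terms of the E i count, as M <= Q. If they all vanish, dividing
   every E i by 'X lowers the total size and takes out a factor 'X^Q, which shifts j by one. *)
have [|all0] := boolP [exists i, (E i).[0] != 0].
  move=> /existsP ex; set W := \sum_i _.
  have dv : 'X^M %| W - \sum_i (E i).[0] *: c i.
    rewrite -sumrB; apply: (big_ind (fun q => 'X^M %| q)) => [|q r|i _].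
    - exact: dvdp0.
    - exact: dvdp_add.
    have [r rE] : exists r, E i = r * 'X + (E i).[0]%:P.
      exists (E i %/ 'X); rewrite {1}(divp_eq (E i) 'X); congr (_ + _).
      have := modp_XsubC (E i) 0; rewrite subr0 => ->; by [].
    rewrite {1}rE comp_polyD comp_polyM comp_polyX comp_polyC mulrDr.
    rewrite [c i * _%:P]mulrC mul_polyC addrK mulrA dvdp_mull //.
    by rewrite dvdp_exp2l.
  have ndv : ~~ ('X^M %| W).
    apply: contra (ind (fun i => (E i).[0]) ex) => dvW.
    by rewrite -(dvdp_addr _ dv) subrK.
  have W0 : W != 0 by apply: contraNneq ndv => ->; rewrite dvdp0.
  have [v [U WE U0]] := poly_lowest_term W0.
  exists 0%N, v, U; split=> //; first by rewrite muln0 add0n.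
  rewrite ltnNge; apply: contra ndv => Mv.
  by rewrite WE dvdp_mulr // dvdp_exp2l.
rewrite negb_exists in all0; move/forallP: all0 => all0.
have EE i : E i = (E i %/ 'X) * 'X.
  by rewrite divpK //; have := dvdp_XsubCl (E i) 0; rewrite subr0 => ->; have := all0 i; rewrite negbK.
have [||j [v [U [WE vM U0]]]] := IHn (fun i => E i %/ 'X).
- rewrite ltnS in ltEn; apply: leq_trans ltEn; rewrite (bigD1 i0) //= [X in (_ < X)%N](bigD1 i0) //=.
  have sE i : size (E i %/ 'X) = (size (E i)).-1 by rewrite size_divp ?polyX_eq0 // size_polyX subn1.
  rewrite -addSn leq_add //; first by rewrite sE prednK // size_poly_gt0.
  by apply: leq_sum => i _; rewrite sE leq_pred.
- by exists i0; apply: contraNneq Ei0 => E0; rewrite EE E0 mul0r.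
exists j.+1, v, U; split=> //.
rewrite mulnS -addnA exprD -mulrA -WE mulr_sumr; apply: eq_bigr => i _.
by rewrite {1}EE comp_polyM comp_polyX [in RHS]mulrCA [X in _ * X]mulrC.
Qed.

(* The summands for different b have X-adic valuations that differ modulo Q. *)
Lemma frobenius_kummer_free (s e l p Q M : nat) (H H1 T : {poly F})
    (E : 'I_s -> 'I_l * 'I_p -> {poly F}) :
  (0 < Q)%N -> (s * e < Q)%N -> (M <= e)%N -> H = 'X^e * H1 -> H1.[0] != 0 ->
  (forall A : {poly {poly F}}, A != 0 -> (size A <= p)%N ->
     (forall i, size (A`_i)%R <= l)%N -> ~~ ('X^M %| A.[T])) ->
  (exists b i, E b i != 0) ->
  \sum_(b < s) H ^+ b * \sum_(i : 'I_l * 'I_p) ('X^(i.1) * T ^+ i.2) * (E b i \Po 'X^Q) != 0.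
Proof.
move=> Q0 seQ Me HE H10 ordT [b0 [i0 E0]].
have s0 : (0 < s)%N by apply: leq_trans (ltn_ord b0).
have MQ : (M <= Q)%N by rewrite (leq_trans Me) // ltnW // (leq_ltn_trans _ seQ) // leq_pmull.
have ind (a : 'I_l * 'I_p -> F) : (exists i, a i != 0) ->
    ~~ ('X^M %| \sum_i a i *: ('X^(i.1) * T ^+ i.2)).
  move=> [[i j] aij].
  pose A : {poly {poly F}} :=
    \poly_(k < p) (if insub k is Some k' then \poly_(i < l) (if insub i is Some i' then a (i', k') else 0) else 0).
  have AE : A.[T] = \sum_i a i *: ('X^(i.1) * T ^+ i.2).
    have -> : \sum_i a i *: ('X^(i.1) * T ^+ i.2) =
        \sum_(i < l) \sum_(j < p) a (i, j) *: ('X^i * T ^+ j).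
      by rewrite pair_bigA; apply: eq_bigr => -[].
    rewrite horner_poly exchange_big /=; apply: eq_bigr => k _.
    rewrite valK poly_def mulr_suml; apply: eq_bigr => i' _.
    by rewrite valK -scalerAl.
  rewrite -AE; apply: ordT.
  - apply: contraNneq aij => A0; have := congr1 (fun q : {poly {poly F}} => (q`_j)`_i) A0.
    by rewrite !coef0 coef_poly ltn_ord valK coef_poly ltn_ord valK => ->.
  - exact: size_poly.
  - move=> k; rewrite coef_poly; case: ltnP => [kp|]; last by rewrite size_poly0.
    by rewrite insubT size_poly.
pose P b := [exists i, E b i != 0].
pose W b := \sum_(i : 'I_l * 'I_p) ('X^(i.1) * T ^+ i.2) * (E b i \Po 'X^Q).
have W0 b : ~~ P b -> W b = 0.
  rewrite /P negb_exists => /forallP e0; rewrite /W big1 // => i _.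
  by have := e0 i; rewrite negbK => /eqP ->; rewrite comp_poly0 mulr0.
have WP b : exists jvU : nat * nat * {poly F}, P b ->
    [/\ W b = 'X^(Q * jvU.1.1 + jvU.1.2) * jvU.2, (jvU.1.2 < M)%N & jvU.2.[0] != 0].
  case Pb : (P b); last by exists (0%N, 0%N, 0).
  have [j [v [U h]]] := frobenius_comb_order Q0 MQ ind (existsP Pb).
  by exists (j, v, U).
have /fin_all_exists [jvU jvUP] := WP.
rewrite (bigID P) /= [X in _ + X]big1 ?addr0 => [|b nPb]; last first.
  by rewrite -/(W b) W0 // mulr0.
apply: (@sum_distinct_order_neq0 _ (fun b : 'I_s => H ^+ b * W b) (fun b => H1 ^+ b * (jvU b).2)
  (fun b => (Q * (jvU b).1.1 + (e * b + (jvU b).1.2))%N) P b0).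
- by apply/existsP; exists i0.
- move=> b Pb; have [WE vM U0] := jvUP b Pb; split.
    rewrite -/(W b) WE HE exprMn -exprM.
    by rewrite mulrACA -exprD; congr ('X^_ * _); lia.
  by rewrite hornerM horner_exp mulf_neq0 ?expf_neq0.
move=> b b' Pb Pb' /= eqn; apply: val_inj.
(* Modulo Q the valuation is e b + v with v < e; this stays below s e < Q, so its quotient by e
   recovers b. *)
have key (c : 'I_s) : P c -> (((Q * (jvU c).1.1 + (e * c + (jvU c).1.2)) %% Q) %/ e = c)%N.
  move=> Pc; have [_ vM _] := jvUP c Pc; have cs := ltn_ord c.
  have e0 : (0 < e)%N by lia.
  have ve : ((jvU c).1.2 < e)%N by lia.
  rewrite mulnC modnMDl modn_small; last by nia.
  by rewrite mulnC divnMDl // divn_small // addn0.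
by have := congr1 (fun x => (x %% Q) %/ e)%N eqn; rewrite !key.
Qed.

End Independence.

Lemma exists_linear_relation (F : fieldType) (I : finType) (f : I -> {poly F}) (N : nat) :
  (forall i, size (f i) <= N)%N -> (N < #|I|)%N ->
  exists2 c : I -> F, exists i, c i != 0 & \sum_i c i *: f i = 0.
Proof.
move=> sf NI; pose A : 'M[F]_(#|I|, N) := \matrix_(i, j) (f (enum_val i))`_j.
have : kermx A != 0.
  by rewrite kermx_eq0 -row_leq_rank -ltnNge (leq_ltn_trans (rank_leq_col A)).
case/rowV0Pn => v /sub_kermxP vA v0.
have [j vj] : exists j, v 0 j != 0.
  apply/existsP; apply: contraR v0; rewrite negb_exists => /forallP e0.
  by apply/eqP/rowP => j; rewrite mxE; have := e0 j; rewrite negbK => /eqP.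
exists (fun i => v 0 (enum_rank i)); first by exists (enum_val j); rewrite enum_valK.
apply/polyP => k; rewrite coef0 coef_sum; case: (ltnP k N) => kN.
  have := congr1 (fun B : 'rV_N => B 0 (Ordinal kN)) vA; rewrite !mxE => vA0; rewrite -[RHS]vA0.
  rewrite (reindex_onto enum_val enum_rank) /=; last by move=> i _; rewrite enum_rankK.
  under eq_bigl do rewrite enum_valK eqxx.
  by apply: eq_bigr => i _; rewrite enum_valK coefZ mxE.
by apply: big1 => i _; rewrite coefZ nth_default ?mulr0 // (leq_trans (sf i)).
Qed.

Section FrobeniusPower.
Variables (R : comNzRingType) (p mu : nat).
Hypothesis chp : p \in [pchar R].

Lemma exprDq (x y : R) : (x + y) ^+ (p ^ mu) = x ^+ (p ^ mu) + y ^+ (p ^ mu).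
Proof.
by apply: exprDn_pchar; rewrite pnatX (pnatE _ (pcharf_prime chp)) chp.
Qed.

Lemma exprNq (x : R) : (- x) ^+ (p ^ mu) = - x ^+ (p ^ mu).
Proof.
have p0 : (0 < p ^ mu)%N by rewrite expn_gt0 prime_gt0 // (pcharf_prime chp).
by apply/eqP; rewrite eq_sym -subr_eq0 -opprD oppr_eq0 -exprDq subrr expr0n gtn_eqF.
Qed.

Lemma expr_sumq (I : Type) (r : seq I) (P : pred I) (f : I -> R) :
  (\sum_(i <- r | P i) f i) ^+ (p ^ mu) = \sum_(i <- r | P i) f i ^+ (p ^ mu).
Proof.
have p0 : (0 < p ^ mu)%N by rewrite expn_gt0 prime_gt0 // (pcharf_prime chp).
by apply: (big_morph (fun x => x ^+ (p ^ mu)) exprDq); rewrite expr0n gtn_eqF.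
Qed.

End FrobeniusPower.

(* On the class defined by u and t the Q-th power of the auxiliary polynomial is,
   up to a power of H, a polynomial of much lower degree, linear in c. *)
Lemma stepanov_aux_frob (F : fieldType) (p mu s l n m Q : nat) (H T : {poly F}) (u t x : F)
    (c : 'I_s * ('I_l * 'I_n) * 'I_m -> F) :
  p \in [pchar F] -> Q = (p ^ mu)%N -> (forall y : F, y ^+ Q ^+ Q = y) ->
  H.[x] != 0 -> H.[x] ^+ Q.+1 = u -> T.[x] + T.[x] ^+ Q = t ->
  H.[x] ^+ s.-1 * (\sum_(b < s) H ^+ b * \sum_(i : 'I_l * 'I_n)
    ('X^(i.1) * T ^+ i.2) * ((\sum_(a < m) c (b, i, a) ^+ Q *: 'X^a) \Po 'X^Q)).[x] ^+ Q =
  (\sum_i c i *: (u ^+ i.1.1 *: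
     ('X^(i.1.2.1 * Q + i.2) * (H ^+ (s.-1 - i.1.1) * (t%:P - T) ^+ i.1.2.2)))).[x].
Proof.
move=> chp QE xQ Hx0 Hx Tx.
(* The two class equations replace Q-th powers of H and T by u / H and t - T; the factor H^(s - 1)
   in front clears the denominators H^b, b <= s - 1. *)
have HQ : H.[x] ^+ Q = u / H.[x] by rewrite -Hx exprSr mulfK.
have TQ : T.[x] ^+ Q = t - T.[x] by rewrite -Tx addrAC subrr add0r.
have sumQ (J : Type) (r : seq J) (P : pred J) (G : J -> F) :
    (\sum_(j <- r | P j) G j) ^+ Q = \sum_(j <- r | P j) G j ^+ Q.
  by rewrite QE; apply: expr_sumq.
have expAC (y : F) k : (y ^+ k) ^+ Q = (y ^+ Q) ^+ k by rewrite -!exprM mulnC.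
set f := fun i : 'I_s * ('I_l * 'I_n) * 'I_m => u ^+ i.1.1 *:
     ('X^(i.1.2.1 * Q + i.2) * (H ^+ (s.-1 - i.1.1) * (t%:P - T) ^+ i.1.2.2)).
have -> : \sum_i c i *: f i = \sum_(b < s) \sum_(i : 'I_l * 'I_n) \sum_(a < m)
    (c (b, i, a) *: f (b, i, a)).
  by rewrite pair_bigA pair_bigA /=; apply: eq_bigr => -[[? ?] ?].
rewrite !horner_sum sumQ mulr_sumr; apply: eq_bigr => b _.
rewrite hornerM horner_exp !horner_sum exprMn mulrA sumQ mulr_sumr.
apply: eq_bigr => i _.
rewrite !hornerM horner_comp !horner_exp !hornerX !horner_sum !exprMn sumQ mulrA mulr_sumr.
apply: eq_bigr => a _.
rewrite !hornerZ !hornerM !horner_exp !hornerX !exprMn xQ.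
rewrite (expAC _ a) xQ (expAC _ b) HQ (expAC _ i.2) TQ.
rewrite hornerD hornerC hornerN exprD -[(x ^+ i.1) ^+ Q]exprM.
have bs : (b <= s.-1)%N by rewrite -ltnS prednK //; apply: leq_ltn_trans (ltn_ord b).
rewrite -{1}(subnK bs) exprD expr_div_n.
have Hb0 : H.[x] ^+ b != 0 by rewrite expf_neq0.
by field.
Qed.

(** * The upper bound for one norm-trace class *)

Section Stepanov.
Variables (F : finFieldType) (p mu K d : nat) (h h1 g : {poly F}).
Let Q := (p ^ mu)%N.
Let s := p.-1.
Let e := (Q.-1 %/ s)%N.
Hypotheses (chp : p \in [pchar F]) (p_gt2 : (2 < p)%N) (mu4 : (4 <= mu)%N).
Hypotheses (cardF : #|F| = (Q ^ 2)%N) (hE : h = 'X * h1) (h1_0 : h1.[0] != 0).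
Hypotheses (sh : size h = K.+1) (sg : size g = d.+1) (d_gt0 : (0 < d)%N) (d_ltp : (d < p)%N).

(** As e (Q + 1) = (Q^2 - 1)/(p - 1), the value H(x)^(Q + 1) is the norm of h(x) down to the prime
    field. Likewise T(x) + T(x)^Q, with T below, is the trace of g(x). *)
Definition frob_norm_poly := h ^+ e.
Definition frob_trace_poly := \sum_(i < mu) g ^+ (p ^ i).
Local Notation H := frob_norm_poly.
Local Notation T := frob_trace_poly.

Let p_pr : prime p. Proof. exact: pcharf_prime chp. Qed.
Let p_gt0 : (0 < p)%N. Proof. exact: prime_gt0. Qed.
Let s_gt0 : (0 < s)%N. Proof. by rewrite /s -ltnS prednK //; lia. Qed.
Let Q_gt0 : (0 < Q)%N. Proof. by rewrite expn_gt0 p_gt0. Qed.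

Let chpX : p \in [pchar {poly F}].
Proof. by rewrite pchar_poly. Qed.

Let es : (e * s = Q.-1)%N.
Proof. by rewrite divnK // /s /Q !predn_exp; apply: dvdn_mulr. Qed.

(** Room for the resultant degree 2 p B with B = p^(mu - 3). Taking B = p^(mu - 2) would fail, since
    e < 2 p^(mu - 1). *)
Let e_big : (2 * p * p ^ (mu - 3) < e)%N.
Proof.
have E : Q = (p ^ (mu - 3) * p * p * p)%N by rewrite -!expnSr /Q; congr (_ ^ _)%N; lia.
have b0 : (0 < p ^ (mu - 3))%N by rewrite expn_gt0 p_gt0.
move: es; rewrite E /s; move: (p ^ _)%N b0 => b b0 e1.
rewrite ltnNge; apply/negP => le.
have : (e * p.-1 <= 2 * p * b * p.-1)%N by rewrite leq_mul2r le orbT.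
rewrite e1; case: p p_gt2 => // q q2 /=; nia.
Qed.

(** T^p - T telescopes to g^Q - g, and g^Q - g(0)^Q = (g - g(0))^Q is divisible by 'X^Q. This trades
    g^Q for a constant, so the equation satisfied by T has coefficients of degree at most d. *)
Lemma frob_trace_AS : 'X^Q %| T ^+ p - T + (g - (g.[0] ^+ Q)%:P).
Proof.
have -> : T ^+ p = \sum_(i < mu) g ^+ (p ^ i.+1).
  rewrite -{1}[p]expn1 (expr_sumq 1 chpX); apply: eq_bigr => i _.
  by rewrite -exprM -expnD addn1.
have -> : \sum_(i < mu) g ^+ (p ^ i.+1) - T + (g - (g.[0] ^+ Q)%:P) = (g - (g.[0])%:P) ^+ Q.
  rewrite exprDq // exprNq // -polyC_exp /T -sumrB.
  rewrite -(big_mkord xpredT (fun i => g ^+ (p ^ i.+1) - g ^+ (p ^ i))).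
  by rewrite telescope_sumr // expn0 expr1 addrA subrK.
have := dvdp_XsubCl (g - (g.[0])%:P) 0; rewrite subr0 => dv.
by apply: dvdp_exp2r; rewrite dv /root !hornerE subrr.
Qed.

Lemma frob_poly_free (E : 'I_s -> 'I_(p ^ (mu - 3)).+1 * 'I_p -> {poly F}) :
  (exists b i, E b i != 0) ->
  \sum_(b < s) H ^+ b * \sum_(i : 'I_(p ^ (mu - 3)).+1 * 'I_p)
     ('X^(i.1) * T ^+ i.2) * (E b i \Po 'X^Q) != 0.
Proof.
apply: (frobenius_kummer_free (e := e) (M := e) (H1 := h1 ^+ e)) => //.
- by rewrite mulnC es prednK.
- by rewrite /frob_norm_poly hE exprMn.
- by rewrite horner_exp expf_neq0.
move=> A A0 sA sAi.
have d_le : (d <= p ^ (mu - 3))%N.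
  rewrite ltnW // (leq_trans d_ltp) // -{1}[p]expn1 leq_pexp2l //; lia.
(* Since y^(Q^2) = y on F, the power p^(2 mu - 1) extracts p-th roots. *)
have [th thE] : exists th, th ^+ p = - lead_coef g.
  exists ((- lead_coef g) ^+ (p ^ (2 * mu).-1)).
  have E2 : (p ^ (2 * mu).-1 * p = #|F|)%N.
    by rewrite cardF -expnSr prednK; [rewrite mulnC expnM | lia].
  by rewrite -exprM E2 expf_card.
have sg' : size (g - (g.[0] ^+ Q)%:P) = d.+1.
  by rewrite size_polyDl ?size_polyN sg // size_polyC; case: (_ != 0).
apply: (@horner_AS_not_dvd F p d (p ^ (mu - 3)) e (g - (g.[0] ^+ Q)%:P) T th) => //.
- by rewrite prime_coprime // gtnNdvd.
- by rewrite d_gt0.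
- rewrite thE lead_coefDl // size_polyN sg size_polyC.
  by case: (_ != 0).
- apply: dvdp_trans frob_trace_AS; rewrite dvdp_exp2l //.
  by rewrite (leq_trans _ (leq_pred Q)) // -es leq_pmulr.
Qed.

Let size_H : (size H <= (K * e).+1)%N.
Proof. by rewrite (leq_trans (size_poly_exp_leq _ _)) // sh. Qed.

Let size_T : (size T <= (d * p ^ mu.-1).+1)%N.
Proof.
rewrite (leq_trans (size_sum _ _ _)) //; apply/bigmax_leqP => i _.
rewrite (leq_trans (size_poly_exp_leq _ _)) // sg ltnS leq_mul2l leq_pexp2l ?orbT //.
by rewrite -ltnS prednK //; lia.
Qed.

Let size_auxM (n b c : nat) (H' T' : {poly F}) : (size H' <= (K * e).+1)%N ->
  (size T' <= (d * p ^ mu.-1).+1)%N -> (b <= s)%N -> (c <= p)%N ->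
  (size ('X^n * (H' ^+ b * T' ^+ c))%R <= n + (K + d) * Q + 1)%N.
Proof.
move=> sH' sT' bs cp.
rewrite (leq_trans (size_polyMleq _ _)) // size_polyXn addSn /= -addnA leq_add2l.
rewrite (leq_trans (size_polyMleq _ _)) //.
have h1' := size_poly_exp_leq H' b; have h2' := size_poly_exp_leq T' c.
have a1 : ((size H').-1 * b <= K * Q)%N.
  rewrite (leq_trans (leq_mul (_ : _ <= K * e)%N bs)) //; first by rewrite -ltnS; case: (size H') sH'.
  by rewrite -mulnA es leq_mul2l leq_pred orbT.
have a2 : ((size T').-1 * c <= d * Q)%N.
  rewrite (leq_trans (leq_mul (_ : _ <= d * p ^ mu.-1)%N cp)) //; first by rewrite -ltnS; case: (size T') sT'.
  by rewrite -mulnA -expnSr prednK //; lia.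
have := leq_add (leq_trans h1' (_ : _ <= (K * Q).+1)%N) (leq_trans h2' (_ : _ <= (d * Q).+1)%N).
rewrite !ltnS => /(_ a1 a2); rewrite mulnDl addSn addnS => h3.
by rewrite -subn1 leq_subLR; move: h3; rewrite add1n addn1.
Qed.

(* The excess m - Q / ((p - 1) p) in the number m of exponents a' below. *)
Definition stepanov_defect := (p ^ 3 * (K + d + 1) + 1)%N.

(** The elements of the class are roots of a nonzero polynomial of degree about Q m, and m exceeds Q
    / ((p - 1) p) by a bounded amount only: the count is the expected Q^2 / ((p - 1) p) up to
    O(Q). *)
Lemma stepanov_class_bound (u t : F) : u != 0 -> (2 * stepanov_defect + 2 <= Q)%N ->
  (#|[set x | ((H.[x] ^+ Q.+1 == u) && (T.[x] + T.[x] ^+ Q == t))%R]| * (s * p)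
     <= Q ^ 2 + Q * (s * p * (stepanov_defect + K + d + 1)))%N.
Proof.
move=> u0 QC; set C1 := stepanov_defect in QC *.
pose l := (p ^ (mu - 3)).+1; pose m := (Q %/ (s * p) + C1)%N.
have sp0 : (0 < s * p)%N by rewrite muln_gt0 s_gt0.
have sp2 : (2 <= s * p)%N by move: s_gt0; nia.
have mE : (Q + s * p * (p ^ 3 * (K + d + 1)) < s * p * m)%N.
  have := ltn_ceil Q sp0; rewrite /m /C1 /stepanov_defect mulSn.
  by move: (s * p)%N (Q %/ _)%N (p ^ 3 * _)%N => z q A; nia.
have mle : (s * p * m <= Q + s * p * C1)%N.
  by rewrite /m mulnDr leq_add2r mulnC leq_divM.
have mQ : (m < Q)%N.
  rewrite /m; have : (Q %/ (s * p) <= Q %/ 2)%N by apply: leq_div2l.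
  by have := divn_eq Q 2; have := ltn_pmod Q (isT : 0 < 2)%N; lia.
have lQ : (Q <= l * p ^ 3)%N.
  rewrite /l mulSn /Q -expnD subnK ?leq_addl //; lia.
pose I : finType := ('I_s * ('I_l * 'I_p) * 'I_m)%type.
pose f (i : I) : {poly F} := u ^+ i.1.1 *:
  ('X^(i.1.2.1 * Q + i.2) * (H ^+ (s.-1 - i.1.1) * (t%:P - T) ^+ i.1.2.2)).
have sf i : (size (f i) <= (l + K + d) * Q + m)%N.
  rewrite /f (leq_trans (size_scale_leq _ _)) //.
  rewrite (leq_trans (size_auxM _ size_H (_ : _ <= (d * p ^ mu.-1).+1)%N _ _)) //.
  - rewrite (leq_trans (size_polyD _ _)) // geq_max size_polyN size_T andbT size_polyC.
    by case: (_ != 0).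
  - by rewrite (leq_trans (leq_subr _ _)) ?leq_pred.
  - exact: ltnW.
  have h1' := ltn_ord i.1.2.1; have h2' := ltn_ord i.2.
  have : (i.1.2.1.+1 * Q <= l * Q)%N by rewrite leq_mul2r h1' orbT.
  rewrite mulSn !mulnDl; move: (l * Q)%N (K * Q)%N (d * Q)%N (i.1.2.1 * Q)%N h2' => ? ? ? ?; lia.
have cardI : #|I| = (l * (s * p * m))%N by rewrite !card_prod !card_ord mulnCA -mulnA.
(* There are l (p - 1) p m unknowns against at most (l + K + d) Q + m coefficients. The main part of
   m pays for l Q; the defect pays for (K + d) Q + m < (K + d + 1) Q because l p^3 >= Q. *)
have [|c [i0 ci0] cf] := exists_linear_relation sf.
  rewrite cardI; apply: leq_trans (leq_mul (leqnn l) (ltnW mE)).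
  have : (Q * (K + d + 1) <= l * (s * p * (p ^ 3 * (K + d + 1))))%N.
    apply: leq_trans (leq_mul lQ (leqnn (K + d + 1)%N)) _.
    by rewrite -mulnA leq_mul2l leq_pmull ?orbT.
  move/(leq_trans _) => hX; rewrite -[(l + K + d)%N]addnA mulnDl mulnDr -addnA ltn_add2l hX //.
  by rewrite [((K + d) * Q)%N]mulnC [X in (_ < X)%N]mulnDr muln1 ltn_add2l.
(* The coefficients are Q-th powers so that the Q-th power of w has the c themselves as coefficients
   on the class, which keeps the vanishing condition linear. *)
pose E (b : 'I_s) (i : 'I_l * 'I_p) : {poly F} := \sum_(a < m) c (b, i, a) ^+ Q *: 'X^a.
pose w := \sum_(b < s) H ^+ b * \sum_(i : 'I_l * 'I_p) ('X^(i.1) * T ^+ i.2) * (E b i \Po 'X^Q).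
have w0 : w != 0.
  apply: frob_poly_free; exists i0.1.1, i0.1.2.
  apply: contraNneq ci0 => E0; have := congr1 (fun q : {poly F} => q`_i0.2) E0.
  rewrite coef0 coef_sum (bigD1 i0.2) //= big1 => [|a ne].
    rewrite addr0 coefZ coefXn eqxx mulr1 => /eqP; rewrite expf_eq0 => /andP[_].
    by case: (i0) => [[? ?] ?].
  by rewrite coefZ coefXn eq_sym val_eqE (negPf ne) mulr0.
have wx x : H.[x] ^+ Q.+1 == u -> T.[x] + T.[x] ^+ Q == t -> root w x.
  move=> /eqP Hx /eqP Tx; have Hx0 : H.[x] != 0.
    by apply: contraNneq u0 => H0; rewrite -Hx H0 expr0n.
  have xQ (y : F) : (y ^+ Q) ^+ Q = y by rewrite -exprM mulnn -cardF expf_card.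
  suff : H.[x] ^+ s.-1 * w.[x] ^+ Q == 0.
    by rewrite mulf_eq0 !expf_eq0 (negPf Hx0) andbF /= => /andP[].
  by rewrite [X in X == _](@stepanov_aux_frob F p mu s l p m Q H T u t x c) // cf horner0.
set S := [set x | _].
have : (size (enum S) < size w)%N.
  apply: max_poly_roots w0 _ (enum_uniq _); apply/allP => x.
  by rewrite mem_enum inE => /andP[]; apply: wx.
rewrite -cardE => ltw.
have szw : (size w <= Q * (m + K + d + 1) )%N.
  rewrite /w (leq_trans (size_sum _ _ _)) //; apply/bigmax_leqP => b _.
  rewrite mulr_sumr (leq_trans (size_sum _ _ _)) //; apply/bigmax_leqP => i _.
  rewrite raddf_sum !mulr_sumr (leq_trans (size_sum _ _ _)) //.
  apply/bigmax_leqP => a _.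
  rewrite /= comp_polyZ -!scalerAr (leq_trans (size_scale_leq _ _)) //.
  rewrite comp_Xn_poly -exprM.
  have -> : H ^+ b * ('X^(i.1) * T ^+ i.2 * 'X^(Q * a)) = 'X^(i.1 + Q * a) * (H ^+ b * T ^+ i.2).
    by rewrite exprD; ring.
  rewrite (leq_trans (size_auxM _ size_H size_T (ltnW (ltn_ord _)) (ltnW (ltn_ord _)))) //.
  have lQ' : (l <= Q)%N.
    rewrite /l /Q ltn_exp2l //; [lia|exact: ltnW].
  have ilt := ltn_ord i.1; have alt := ltn_ord a.
  have : (Q * a.+1 <= Q * m)%N by rewrite leq_mul2l alt orbT.
  rewrite mulnS !mulnDr muln1; move: (Q * m)%N (Q * a)%N => X Y; rewrite mulnDl ![(_ * Q)%N]mulnC.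
  by move: (Q * K)%N (Q * d)%N => Z1 Z2; lia.
have : (#|S| <= Q * (m + K + d + 1))%N by apply: leq_trans (ltnW ltw) szw.
move=> cS; rewrite (leq_trans (leq_mul cS (leqnn _))) //.
rewrite -mulnA -[(Q ^ 2)%N]mulnn -mulnDr leq_mul2l; apply/orP; right.
move: mle; rewrite [((m + K + d + 1) * _)%N]mulnC; move: (s * p)%N => z; rewrite !mulnDr.
by move: (z * m)%N (z * C1)%N (z * K)%N (z * d)%N (z * 1)%N => *; lia.
Qed.

End Stepanov.

(** * The L-function of a multiplicative function on polynomials *)

Section MonicPolys.
Variable k : finFieldType.

(** Row vectors make the monic polynomials of a given degree a finite type, over which sums can be
    reindexed. *)
Definition monic_of (n : nat) (v : 'rV[k]_n) : {poly k} := 'X^n + rVpoly v.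

Lemma size_monic_of n (v : 'rV[k]_n) : size (monic_of v) = n.+1.
Proof. by rewrite /monic_of size_polyDl size_polyXn // ltnS size_poly. Qed.

Lemma monic_of_monic n (v : 'rV[k]_n) : monic_of v \is monic.
Proof.
by rewrite monicE lead_coefE size_monic_of coefD coefXn eqxx /= nth_default ?addr0 ?size_poly.
Qed.

Lemma monic_of_neq0 n (v : 'rV[k]_n) : monic_of v != 0.
Proof. exact: monic_neq0 (monic_of_monic v). Qed.

Lemma size_monic_of_exp n (v : 'rV[k]_n) j : size (monic_of v ^+ j) = (n * j).+1.
Proof.
rewrite -[LHS]prednK ?size_exp ?size_monic_of //.
by rewrite size_poly_gt0 expf_neq0 // monic_of_neq0.
Qed.

Lemma monic_of_inj n : injective (@monic_of n).
Proof. by move=> v w /addrI /(congr1 (@poly_rV k n)); rewrite !rVpolyK. Qed.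

Lemma monic_of_surj (P : {poly k}) : P \is monic -> {v : 'rV[k]_(size P).-1 | P = monic_of v}.
Proof.
move=> Pm; have P0 : (0 < size P)%N by rewrite size_poly_gt0 monic_neq0.
exists (poly_rV (P - 'X^((size P).-1))); rewrite /monic_of poly_rV_K; first by rewrite addrC subrK.
apply/leq_sizeP => j; rewrite leq_eqVlt => /orP[/eqP <-|lt].
  by rewrite coefB coefXn eqxx; move: Pm; rewrite monicE => /eqP; rewrite lead_coefE => ->; rewrite subrr.
by rewrite coefB coefXn gtn_eqF // subr0 nth_default // -(prednK P0).
Qed.

Lemma monic_of_exists n (P : {poly k}) : P \is monic -> size P = n.+1 -> exists v : 'rV[k]_n, P = monic_of v.
Proof. by move=> Pm sP; have [] := monic_of_surj Pm; rewrite sP /= => v; exists v. Qed.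

Definition monic_irr (e : nat) (v : 'rV[k]_e) :=
  (0 < e)%N && [forall d : 'I_e, (0 < d)%N ==> [forall w : 'rV[k]_d, ~~ (monic_of w %| monic_of v)]].

Lemma monic_irrP e (v : 'rV[k]_e) : reflect (irreducible_poly (monic_of v)) (monic_irr v).
Proof.
apply: (iffP andP) => [[e0 /forallP irr]|[sv irr]].
  split; first by rewrite size_monic_of.
  move=> q sq qv; have q0 : q != 0 by apply: dvdpN0 qv (monic_of_neq0 v).
  have lc0 : lead_coef q != 0 by rewrite lead_coef_eq0.
  have qm : (lead_coef q)^-1 *: q \is monic by rewrite monicE lead_coefZ mulVf.
  have qE : (lead_coef q)^-1 *: q %= q by rewrite eqp_scale // invr_eq0.
  have le : (size q <= e.+1)%N by rewrite -(size_monic_of v) dvdp_leq // monic_of_neq0.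
  have sq0 : (0 < size q)%N by rewrite size_poly_gt0.
  rewrite -dvdp_size_eqp // size_monic_of eqn_leq le /= ltnNge.
  apply/negP => sqe.
  have lt : ((size q).-1 < e)%N by rewrite prednK.
  have := irr (Ordinal lt); rewrite /= -ltnS prednK // ltn_neqAle eq_sym sq sq0 /=.
  have sqm : size ((lead_coef q)^-1 *: q) = (size q).-1.+1 by rewrite size_scale ?invr_eq0 // prednK.
  have [w wE] := monic_of_exists qm sqm.
  by move/forallP/(_ w); rewrite -wE (eqp_dvdl _ qE) qv.
split; first by rewrite -ltnS -(size_monic_of v).
apply/forallP => d; apply/implyP => d0; apply/forallP => w; apply/negP => dv.
have := irr _ _ dv; rewrite size_monic_of eqSS -lt0n d0 => /(_ isT)/eqp_size.
by rewrite !size_monic_of => -[de]; have := ltn_ord d; rewrite de ltnn.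
Qed.

Lemma exists_monic_irr (P : {poly k}) : P \is monic -> (1 < size P)%N ->
  exists e, exists2 v : 'rV[k]_e, monic_irr v & monic_of v %| P.
Proof.
have [n] := ubnP (size P); elim: n P => // n IHn P; rewrite ltnS => sPn Pm sP.
have [v PE] := monic_of_surj Pm; have [irr|] := boolP (monic_irr v).
  by exists (size P).-1, v => //; rewrite -PE.
rewrite negb_and -leqNgt leqn0 => /orP[/eqP s0|].
  by move: sP s0; case: (size P) => // -[].
rewrite negb_forall => /existsP[d]; rewrite negb_imply => /andP[d0].
rewrite negb_forall => /existsP[w]; rewrite negbK -PE => wP.
have sw : (size (monic_of w) < n)%N.
  by rewrite size_monic_of (leq_trans _ sPn) // -ltn_predRL.
have [|e [u iu uw]] := IHn _ sw (monic_of_monic w).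
  by rewrite size_monic_of ltnS.
by exists e, u => //; apply: dvdp_trans uw wP.
Qed.

Lemma monic_irr_gt0 e (v : 'rV[k]_e) : monic_irr v -> (0 < e)%N.
Proof. by case/andP. Qed.

(** Polynomial analogue of the sum of the von Mangoldt function over the divisors of an integer:
    each irreducible factor counts its degree once per power dividing P. The cutoff N, on degrees
    and exponents, keeps the sums finite. *)
Definition factor_degree (N : nat) (P : {poly k}) : nat :=
  \sum_(1 <= e < N.+1) \sum_(v : 'rV[k]_e | monic_irr v)
    e * \sum_(1 <= j < N.+1) (monic_of v ^+ j %| P)%R.

Lemma factor_degreeE N (P : {poly k}) : P \is monic -> ((size P).-1 <= N)%N ->
  factor_degree N P = (size P).-1.
Proof.
have [n] := ubnP (size P); elim: n P => // n IHn P; rewrite ltnS => sPn Pm sPN.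
have [sP|sP] := leqP (size P) 1.
  have PE : P = 1.
    have := size1_polyC sP => E; move: Pm; rewrite E monicE lead_coefC => /eqP ->; by [].
  rewrite PE size_poly1 /factor_degree big1_seq // => e /andP[_]; rewrite mem_index_iota => /andP[e1 _].
  rewrite big1 // => v iv; rewrite big1_seq ?muln0 // => j /andP[_]; rewrite mem_index_iota => /andP[j1 _].
  by rewrite dvdp1 size_monic_of_exp eqSS muln_eq0 !gtn_eqF.
have [e0 [r ir /dvdpP[P' PE]]] := exists_monic_irr Pm sP.
have e0_gt0 := monic_irr_gt0 ir.
have P'm : P' \is monic by move: Pm; rewrite PE monicMr // monic_of_monic.
have sPE : size P = (size P' + e0)%N.
  by rewrite PE size_Mmonic ?monic_of_monic ?monic_neq0 // size_monic_of addnS.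
have sP'0 : (0 < size P')%N by rewrite size_poly_gt0 monic_neq0.
have e0N : (e0 <= N)%N by rewrite (leq_trans _ sPN) // sPE -(prednK sP'0) addSn /= leq_addl.
have step : factor_degree N P = (factor_degree N P' + e0)%N.
  rewrite /factor_degree.
  (* Passing from P' to P = P' r raises the multiplicity of r by one and no other. The cutoff loses
     nothing, as r^N is too large to divide P'. *)
  have key e (v : 'rV[k]_e) : monic_irr v ->
    (\sum_(1 <= j < N.+1) (monic_of v ^+ j %| P)%R =
     \sum_(1 <= j < N.+1) (monic_of v ^+ j %| P')%R + (monic_of v == monic_of r))%N.
    move=> iv; case: eqP => [vr|vr]; last first.
      rewrite addn0; apply: eq_bigr => j _; rewrite PE; congr (nat_of_bool _).
      apply: Gauss_dvdpl; apply: coprimep_expl.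
      have [_ irv] := monic_irrP _ iv; have [_ irr] := monic_irrP _ ir.
      rewrite irreducible_poly_coprime; last exact/monic_irrP.
      apply/negP => dv; apply: vr; apply/eqP; rewrite -eqp_monic ?monic_of_monic //.
      by apply: irr; rewrite // size_monic_of eqSS -lt0n (monic_irr_gt0 iv).
    have Nt : (1 < N.+1)%N by rewrite ltnS (leq_trans e0_gt0).
    rewrite vr big_ltn //;
    rewrite -[monic_of r ^+ 1]/(monic_of r) PE dvdp_mull // [in RHS]big_nat_recr /=; last by rewrite (leq_trans e0_gt0).
    have -> : (monic_of r ^+ N %| P') = false.
      apply/negP => /(dvdp_leq (monic_neq0 P'm)).
      rewrite size_monic_of_exp ltnNge => /negP; apply.
      apply: leq_trans (_ : (size P').-1 + e0 <= _)%N.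
        by rewrite -{1}(prednK sP'0) -addn1 leq_add2l.
      rewrite (leq_trans (_ : _ <= N)%N) ?leq_pmull //.
      by rewrite (leq_trans _ sPN) // sPE -(prednK sP'0) addSn.
    rewrite addn0 addnC; congr (_ + _)%N; rewrite big_add1 /=.
    apply: eq_bigr => j _; rewrite exprSr dvdp_mul2r ?monic_of_neq0 //.
  under eq_bigr => e _ do under eq_bigr => v iv do rewrite key // mulnDr.
  under eq_bigr => e _ do rewrite big_split /=.
  rewrite big_split /=; congr (_ + _)%N.
  rewrite (bigD1_seq e0) ?iota_uniq ?mem_index_iota ?e0_gt0 ?ltnS //=.
  rewrite (bigD1 r) //= eqxx muln1 big1 => [|v /andP[_ vr]]; last first.
    by rewrite (inj_eq (@monic_of_inj _)) (negPf vr) muln0.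
  rewrite addn0 big1 ?addn0 // => e ee0; rewrite big1 // => v _.
  case: eqP => [/(congr1 (fun q : {poly k} => size q))|]; last by rewrite muln0.
  by rewrite !size_monic_of => -[/eqP]; rewrite (negPf ee0).
rewrite step IHn //; last 2 first.
- by rewrite (leq_trans _ sPn) // sPE -addn1 leq_add2l.
- by rewrite (leq_trans _ sPN) // sPE -(prednK sP'0) addSn leq_addr.
by rewrite sPE -(prednK sP'0) addSn.
Qed.

End MonicPolys.

Section LFunction.
Variables (k : finFieldType) (C : comNzRingType) (lam : {poly k} -> C).
Hypothesis lam1 : lam 1 = 1.
Hypothesis lamM : forall P Q, P \is monic -> Q \is monic -> lam (P * Q) = lam P * lam Q.

Definition L_coef (n : nat) : C := \sum_(v : 'rV[k]_n) lam (monic_of v).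

(** The coefficient of X^nu in X L'/L, where L is the generating series of [L_coef]: the powers of
    degree nu of irreducibles P, weighted by deg P. *)
Definition prime_power_sum (nu : nat) : C :=
  \sum_(1 <= e < nu.+1 | (e %| nu)%N) \sum_(v : 'rV[k]_e | monic_irr v)
    e%:R * lam (monic_of v) ^+ (nu %/ e).

Lemma lamX (P : {poly k}) j : P \is monic -> lam (P ^+ j) = lam P ^+ j.
Proof.
move=> Pm; elim: j => [|j IHj]; first by rewrite !expr0.
by rewrite !exprS lamM ?monic_exp // IHj.
Qed.

Lemma sum_multiples (m n : nat) (R : {poly k}) : R \is monic -> size R = m.+1 ->
  \sum_(v : 'rV[k]_n | R %| monic_of v) lam (monic_of v) =
  if (m <= n)%N then lam R * L_coef (n - m) else 0.
Proof.
move=> Rm sR; case: leqP => mn; last first.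
  apply: big1 => v /(dvdp_leq (monic_of_neq0 v)).
  by rewrite sR size_monic_of ltnS leqNgt mn.
pose h (w : 'rV[k]_(n - m)) : 'rV[k]_n := poly_rV (R * monic_of w - 'X^n).
pose g (v : 'rV[k]_n) : 'rV[k]_(n - m) := poly_rV (monic_of v %/ R - 'X^(n - m)).
have monic_ofK l (P : {poly k}) : P \is monic -> size P = l.+1 -> monic_of (poly_rV (P - 'X^l) : 'rV_l) = P.
  move=> Pm sP; have [v ->] := monic_of_exists Pm sP.
  by rewrite {2}/monic_of addrAC subrr add0r rVpolyK.
have hE w : monic_of (h w) = R * monic_of w.
  apply: monic_ofK; first by rewrite monicMl ?monic_of_monic.
  by rewrite size_monicM ?monic_of_neq0 // sR size_monic_of addSn /= addnS subnKC.
have gE v : R %| monic_of v -> R * monic_of (g v) = monic_of v.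
  move=> dv; rewrite monic_ofK; first by rewrite mulrC divpK.
    by rewrite -(monicMr _ Rm) divpK // monic_of_monic.
  by rewrite size_divp ?monic_neq0 // size_monic_of sR /= subSn.
have hg v : R %| monic_of v -> h (g v) = v.
  by move=> dv; apply: (@monic_of_inj k n); rewrite hE gE.
rewrite (reindex_onto h g) // /L_coef mulr_sumr.
apply: eq_big => [w|w _]; last by rewrite hE lamM ?monic_of_monic.
rewrite hE dvdp_mulr ?dvdpp //=; apply/eqP/(@monic_of_inj k (n - m)).
apply/(mulfI (monic_neq0 Rm)).
by rewrite gE ?hE // dvdp_mulr ?dvdpp.
Qed.

(** Coefficientwise form of X L' = L (X L'/L), proved without an Euler product: n is rewritten as
    the [factor_degree] of each monic polynomial of degree n, and the sums are exchanged. *)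
Lemma L_coef_newton (n : nat) :
  n%:R * L_coef n = \sum_(1 <= nu < n.+1) prime_power_sum nu * L_coef (n - nu).
Proof.
transitivity (\sum_(1 <= e < n.+1) \sum_(u : 'rV[k]_e | monic_irr u)
   \sum_(1 <= j < n.+1) e%:R * (if (e * j <= n)%N then lam (monic_of u) ^+ j * L_coef (n - e * j) else 0)).
  rewrite /L_coef mulr_sumr.
  transitivity (\sum_(v : 'rV[k]_n) \sum_(1 <= e < n.+1) \sum_(u : 'rV[k]_e | monic_irr u)
     \sum_(1 <= j < n.+1) (if monic_of u ^+ j %| monic_of v then e%:R * lam (monic_of v) else 0)).
    apply: eq_bigr => v _.
    have := @factor_degreeE k n (monic_of v) (monic_of_monic v).
    rewrite size_monic_of => /(_ (leqnn n)) /= fE; rewrite -[n in n%:R]fE /factor_degree natr_sum mulr_suml.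
    apply: eq_bigr => e _; rewrite natr_sum mulr_suml; apply: eq_bigr => u _.
    rewrite natrM natr_sum mulr_sumr mulr_suml; apply: eq_bigr => j _.
    by case: (_ %| _); rewrite ?mulr1 ?mulr0 ?mul0r.
  rewrite exchange_big /=; apply: eq_bigr => e _.
  rewrite exchange_big /=; apply: eq_bigr => u iu.
  rewrite exchange_big /=; apply: eq_bigr => j _.
  rewrite -big_mkcond -mulr_sumr (@sum_multiples (e * j)) ?lamX ?monic_exp ?monic_of_monic //.
  by rewrite size_monic_of_exp.
transitivity (\sum_(1 <= nu < n.+1) \sum_(1 <= e < n.+1) \sum_(u : 'rV[k]_e | monic_irr u)
   \sum_(1 <= j < n.+1) (if nu == (e * j)%N then e%:R * lam (monic_of u) ^+ j * L_coef (n - nu) else 0)).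
  rewrite [RHS]exchange_big /=; apply: eq_big_nat => e /andP[e1 _].
  rewrite [RHS]exchange_big /=; apply: eq_bigr => u _.
  rewrite [RHS]exchange_big /=; apply: eq_big_nat => j /andP[j1 _].
  rewrite -big_mkcond /=; case: leqP => ejn.
    by rewrite big_nat1_eq muln_gt0 e1 j1 ltnS ejn mulrA.
  rewrite mulr0 big1_seq // => nu; rewrite mem_index_iota => /and3P[/eqP -> _].
  by rewrite ltnS leqNgt ejn.
apply: eq_big_nat => nu /andP[nu1 nun].
rewrite /prime_power_sum [in RHS]mulr_suml.
rewrite (big_cat_nat (n := nu.+1)) //= [X in _ + X]big1_seq ?addr0; last first.
  move=> e /andP[_]; rewrite mem_index_iota => /andP[enu _].
  apply: big1 => u _; rewrite big1_seq // => j /andP[_]; rewrite mem_index_iota => /andP[j1 _].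
  by case: eqP => // E; move: enu; rewrite E ltnNge leq_pmulr.
rewrite [in RHS]big_mkcond /=; apply: eq_big_nat => e /andP[e1 enu].
case: ifP => dv; last first.
  apply: big1 => u _; apply: big1 => j _; case: eqP => // E.
  by move: dv; rewrite E dvdn_mulr.
rewrite mulr_suml; apply: eq_bigr => u _; rewrite -big_mkcond /=.
under eq_bigl => j do rewrite -{1}(divnK dv) mulnC eqn_pmul2l // eq_sym.
rewrite big_nat1_eq divn_gt0 // -ltnS enu ltnS /=.
by rewrite (leq_trans (leq_div _ _)).
Qed.

End LFunction.

Section RootTrace.
Variable k : fieldType.

(* The sum of g over the roots of P with multiplicity, read off the expansion at
   infinity of g P' / P; this avoids any splitting field. *)
Definition root_trace (g P : {poly k}) : k := (('X * g * P^`()) %/ P)`_0.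

Lemma root_trace1 g : root_trace g 1 = 0.
Proof. by rewrite /root_trace derivC mulr0 div0p coef0. Qed.

Lemma root_traceM g P Q : P != 0 -> Q != 0 ->
  root_trace g (P * Q) = root_trace g P + root_trace g Q.
Proof.
move=> P0 Q0; rewrite /root_trace -coefD.
apply: (congr1 (fun q : {poly k} => q`_0)).
rewrite derivM mulrDr divpD; congr (_ + _).
  by rewrite mulrA divp_pmul2r.
by rewrite [P * _]mulrC mulrA [P * Q]mulrC divp_pmul2r.
Qed.

Lemma root_trace_XsubC g a : root_trace g ('X - a%:P) = g.[a].
Proof.
rewrite /root_trace derivXsubC mulr1.
have : root (g - g.[a]%:P) a by rewrite /root !hornerE subrr.
rewrite -dvdp_XsubCl => /dvdpP[q gE].
have -> : 'X * g = ('X * q + g.[a]%:P) * ('X - a%:P) + (a * g.[a])%:P.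
  by rewrite -[g in LHS](subrK g.[a]%:P) gE polyCM; ring.
rewrite divp_addl_mul_small; last by rewrite size_XsubC ltnS size_polyC leq_b1.
by rewrite coefD coefXM coefC add0r.
Qed.

(** The power sums of the roots up to exponent d depend only on the d + 1 top coefficients. Here the
    quotient q for P also serves P + E, since the corrected remainder still has degree below n. *)
Lemma root_trace_add (g P E : {poly k}) d n : size P = n.+1 -> (size g <= d.+1)%N -> (size E + d <= n)%N ->
  root_trace g (P + E) = root_trace g P.
Proof.
move=> sP sg sE; rewrite /root_trace.
apply: (congr1 (fun q : {poly k} => q`_0)).
have P0 : P != 0 by rewrite -size_poly_eq0 sP.
have sPE : size (P + E) = n.+1 by rewrite size_polyDl // sP ltnS (leq_trans (leq_addr d _)).
pose A := 'X * g * P^`(); rewrite -/A; set q := A %/ P.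
have [E0|E0] := eqVneq E 0; first by rewrite /q /A E0 addr0.
have sE0 : (0 < size E)%N by rewrite size_poly_gt0.
have sXg (R : {poly k}) m : (size R <= m)%N -> (size ('X * g * R)%R <= d.+1 + m)%N.
  move=> sR; rewrite -mulrA (leq_trans (size_polyMleq _ _)) // size_polyX /=.
  have [->|R0] := eqVneq R 0; first by rewrite mulr0 size_poly0 addSn.
  rewrite addSn ltnS (leq_trans (size_polyMleq _ _)) // -ltnS prednK.
    by rewrite -addSn leq_add.
  by rewrite addn_gt0 !size_poly_gt0 R0 orbT.
have sq : (size q <= d.+1)%N.
  rewrite size_divp // sP /= leq_subLR addnC; apply: sXg.
  by rewrite -ltnS -sP lt_size_deriv.
have -> : 'X * g * (P + E)^`() = q * (P + E) + (A %% P + 'X * g * E^`() - q * E).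
  by rewrite derivD mulrDr -/A {1}(divp_eq A P) -/q; ring.
rewrite divp_addl_mul_small // sPE.
rewrite ltnS (leq_trans (size_polyD _ _)) // geq_max size_polyN; apply/andP; split.
  rewrite (leq_trans (size_polyD _ _)) // geq_max -ltnS -sP ltn_modp P0 /=.
  apply: leq_trans (sXg _ (size E).-1 _) _; last by rewrite addSn -addnS prednK // addnC.
  by rewrite -ltnS prednK // lt_size_deriv.
rewrite (leq_trans (size_polyMleq _ _)) // -subn1 leq_subLR add1n.
by rewrite (leq_trans (leq_add sq (leqnn _))) // addSn ltnS addnC.
Qed.

End RootTrace.

Lemma root_trace_map (k L : fieldType) (f : {rmorphism k -> L}) (g P : {poly k}) :
  root_trace (map_poly f g) (map_poly f P) = f (root_trace g P).
Proof.
by rewrite /root_trace -coef_map map_divp !rmorphM /= map_polyX deriv_map.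
Qed.

Section MixedCharacter.
Variables (k : finFieldType) (C : idomainType) (chi psi : k -> C).
Hypotheses (chi1 : chi 1 = 1) (chiM : forall x y, chi (x * y) = chi x * chi y).
Hypotheses (psi0 : psi 0 = 1) (psiD : forall x y, psi (x + y) = psi x * psi y).
Variables (K d : nat) (a : nat -> k) (g : {poly k}).

(** The multiplicative extension to monic polynomials of the summand of the character sum, which is
    its value at the linear polynomials 'X - x. *)
Definition mixed_lam (P : {poly k}) : C :=
  chi (\prod_(i < K) P.[a i]) * psi (root_trace g P).

Lemma mixed_lam1 : mixed_lam 1 = 1.
Proof.
rewrite /mixed_lam root_trace1 psi0 mulr1 big1 ?chi1 // => i _.
by rewrite hornerC.
Qed.

Lemma mixed_lamM P Q : P \is monic -> Q \is monic ->
  mixed_lam (P * Q) = mixed_lam P * mixed_lam Q.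
Proof.
move=> Pm Qm; rewrite /mixed_lam root_traceM ?monic_neq0 // psiD.
under eq_bigr do rewrite hornerM.
by rewrite big_split /= chiM mulrACA.
Qed.

Lemma mixed_lam_XsubC x :
  mixed_lam ('X - x%:P) = chi (\prod_(i < K) (a i - x)) * psi g.[x].
Proof.
rewrite /mixed_lam root_trace_XsubC.
by under eq_bigr do rewrite hornerXsubC.
Qed.

Lemma mixed_L_coef0 : L_coef mixed_lam 0 = 1.
Proof.
rewrite /L_coef (big_pred1 (0 : 'rV_0)) => [|v]; last by rewrite thinmx0 /= eqxx.
rewrite /monic_of expr0 (_ : rVpoly 0 = 0) ?addr0 ?mixed_lam1 //.
by rewrite raddf0.
Qed.

Lemma mixed_L_coef1 :
  L_coef mixed_lam 1 = \sum_x chi (\prod_(i < K) (a i - x)) * psi g.[x].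
Proof.
rewrite /L_coef (reindex (fun x : k => \row_(j < 1) - x)) /=; last first.
  exists (fun v : 'rV[k]_1 => - v 0 0) => [x _|v _]; first by rewrite mxE opprK.
  by apply/rowP => j; rewrite mxE opprK ord1.
apply: eq_bigr => x _; rewrite -mixed_lam_XsubC; congr mixed_lam.
rewrite /monic_of /rVpoly expr1; congr (_ + _).
apply/polyP => j; rewrite coefN coefC coef_poly; case: j => [|j] /=; last by rewrite oppr0.
by case: insubP => //= j _ _; rewrite mxE.
Qed.

Hypotheses (K_gt0 : (0 < K)%N) (sg : (size g <= d.+1)%N).
Hypothesis a_inj : forall i, (0 < i < K)%N -> a i != a 0.
Hypothesis chi_nontrivial : exists2 u, u != 0 & chi u != 1.

(* Multiplying the value of P at a 0 by u, without changing its values at the other a i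
   nor its d + 1 leading coefficients, permutes the monic polynomials of degree n and
   multiplies mixed_lam by chi u. *)
Lemma mixed_L_coef_eq0 n : (K + d <= n)%N -> L_coef mixed_lam n = 0.
Proof.
move=> Kdn; have [u u0 chiu] := chi_nontrivial.
(* A Lagrange polynomial: 1 at a 0 and 0 at the other a i. Its degree is at most K - 1 <= n - d - 1,
   so adding multiples of it leaves [root_trace g] unchanged. *)
pose E := \prod_(i < K.-1) ((a 0 - a i.+1)^-1 *: ('X - (a i.+1)%:P)).
have E0 : E.[a 0] = 1.
  rewrite horner_prod big1 // => i _.
  rewrite hornerZ hornerXsubC mulVf // subr_eq0 eq_sym a_inj //=.
  by have := ltn_ord i; rewrite -ltnS prednK.
have Ei i : (0 < i < K)%N -> E.[a i] = 0.
  case: i => // i /= iK; have iK' : (i < K.-1)%N by rewrite -ltnS prednK.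
  rewrite horner_prod (bigD1 (Ordinal iK')) //= hornerZ hornerXsubC subrr mulr0.
  by rewrite mul0r.
have sE : (size E <= K)%N.
  have := size_poly_prod_leq predT (fun i : 'I_K.-1 => (a 0 - a i.+1)^-1 *: ('X - (a i.+1)%:P)).
  move/leq_trans; apply; rewrite leq_subLR cardE size_enum_ord.
  apply: leq_trans (_ : (\sum_(i < K.-1) 2).+1 <= _)%N.
    rewrite ltnS; apply: leq_sum => i _.
    by rewrite (leq_trans (size_scale_leq _ _)) // size_XsubC.
  rewrite sum_nat_const card_ord; lia.
have En : (size E <= n)%N by rewrite (leq_trans sE) // (leq_trans _ Kdn) // leq_addr.
pose ph w (v : 'rV[k]_n) := v + ((w - 1) * (monic_of v).[a 0]) *: poly_rV E.
have phE w v : monic_of (ph w v) = monic_of v + ((w - 1) * (monic_of v).[a 0]) *: E.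
  by rewrite /monic_of /ph linearD linearZ /= poly_rV_K // addrA.
have ph0 w v : (monic_of (ph w v)).[a 0] = w * (monic_of v).[a 0].
  by rewrite phE hornerD hornerZ E0; ring.
have phK w w' : w' * w = 1 -> cancel (ph w) (ph w').
  move=> ww v; rewrite {1}/ph ph0 /ph -addrA -scalerDl.
  rewrite mulrA -mulrDl [(w' - 1) * w]mulrBl ww mul1r addrC subrKA.
  by rewrite subrr mul0r scale0r add0r.
have phB : bijective (ph u).
  by exists (ph u^-1); apply: phK; rewrite ?mulVf ?mulfV.
have lamph v : mixed_lam (monic_of (ph u v)) = chi u * mixed_lam (monic_of v).
  rewrite /mixed_lam phE (@root_trace_add _ g _ _ d n) ?size_monic_of //; last first.
    by rewrite (leq_trans _ Kdn) // leq_add2r (leq_trans (size_scale_leq _ _)).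
  rewrite mulrA -chiM -phE; congr (chi _ * _).
  rewrite -(prednK K_gt0) !big_ord_recl ph0 mulrA; congr (_ * _).
  apply: eq_bigr => i _; rewrite phE hornerD hornerZ Ei ?mulr0 ?addr0 //.
  by rewrite lift0 /=; have := ltn_ord i; rewrite -ltnS prednK.
have : L_coef mixed_lam n = chi u * L_coef mixed_lam n.
  rewrite {1}/L_coef (reindex (ph u)) /=; last exact: onW_bij.
  by rewrite mulr_sumr; apply: eq_bigr => v _; rewrite lamph.
move/eqP; rewrite -{1}[L_coef _ _]mul1r -subr_eq0 -mulrBl mulf_eq0 subr_eq0.
by rewrite eq_sym (negPf chiu) => /eqP.
Qed.

End MixedCharacter.

Lemma monic_irr_dvd_XqX (k : finFieldType) (e : nat) (v : 'rV[k]_e) :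
  monic_irr v -> monic_of v %| 'X^(#|k| ^ e) - 'X.
Proof.
move=> iv; have irr : monic_irreducible_poly (monic_of v).
  by split; [apply/monic_irrP | apply: monic_of_monic].
set x : {poly %/ monic_of v with irr} := in_qpoly (monic_of v) 'X.
have card : #|{poly %/ monic_of v with irr}| = (#|k| ^ e)%N.
  by rewrite (card_qfpoly irr) size_monic_of.
have : x ^+ (#|k| ^ e) = x by rewrite -card expf_card.
rewrite -rmorphXn /= => /(congr1 val) /=.
rewrite (mk_monicE irr) -!Pdiv.IdomainMonic.modpE ?monic_of_monic // => E.
by rewrite /dvdp modpD modpN E subrr.
Qed.

(** * Sums over extension fields *)

Section FrobeniusOrbits.
Variables (p nu : nat) (L : finFieldType) (f : {rmorphism 'F_p -> L}).
Hypotheses (p_pr : prime p) (chL : p \in [pchar L]) (cardL : #|L| = (p ^ nu)%N).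

Definition frob (x : L) : L := x ^+ p.

Lemma frob_inj : injective frob.
Proof. exact: fmorph_inj (pFrobenius_aut chL). Qed.

Lemma iter_frob i x : iter i frob x = x ^+ (p ^ i).
Proof.
elim: i => [|i IHi] /=; first by rewrite expn0 expr1.
by rewrite IHi /frob -exprM -expnSr.
Qed.

Lemma iter_frob_nu x : iter nu frob x = x.
Proof. by rewrite iter_frob -cardL expf_card. Qed.

Lemma frob_fixed (x : L) : x ^+ p = x -> exists c, x = f c.
Proof.
move=> xp; have := congr1 (map_poly f) (finField_genPoly 'F_p).
rewrite card_Fp // rmorphB /= map_polyXn map_polyX rmorph_prod /=.
move/(congr1 (fun q : {poly L} => q.[x])).
rewrite hornerD hornerN hornerXn hornerX xp subrr horner_prod => /esym/eqP.
rewrite prodf_seq_eq0 => /hasP[c _]; rewrite rmorphB /= map_polyX map_polyC /= hornerXsubC subr_eq0.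
by move/eqP; exists c.
Qed.

Definition orbit_poly (x : L) : {poly L} := \prod_(y <- fingraph.orbit frob x) ('X - y%:P).

Lemma orbit_frob_perm x : perm_eq (map frob (fingraph.orbit frob x)) (fingraph.orbit frob x).
Proof.
have us : uniq (map frob (fingraph.orbit frob x)) by rewrite (map_inj_uniq frob_inj) orbit_uniq.
have sub : {subset map frob (fingraph.orbit frob x) <= fingraph.orbit frob x}.
  move=> _ /mapP[y yx ->]; move: yx; rewrite -!fconnect_orbit => yx.
  exact: connect_trans yx (fconnect1 _ _).
have [|_ eqi] := uniq_min_size us sub; first by rewrite size_map.
by apply: uniq_perm; rewrite ?orbit_uniq.
Qed.

(* The coefficients of orbit_poly x are fixed by Frobenius, so [pick] never fails. *)
Definition min_poly (x : L) : {poly 'F_p} :=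
  \poly_(i < size (orbit_poly x)) odflt 0 [pick c | (orbit_poly x)`_i == f c].

Lemma map_min_poly x : map_poly f (min_poly x) = orbit_poly x.
Proof.
have fx : map_poly (pFrobenius_aut chL) (orbit_poly x) = orbit_poly x.
  rewrite /orbit_poly rmorph_prod /=.
  under eq_bigr do rewrite rmorphB /= map_polyX map_polyC /=.
  by rewrite -(big_map frob xpredT (fun y => 'X - y%:P)); apply: perm_big; apply: orbit_frob_perm.
apply/polyP => i; rewrite coef_map coef_poly; case: ltnP => si; last first.
  by rewrite nth_default //; apply: raddf0.
case: pickP => [c /eqP -> //|nc].
have [c cE] : exists c, (orbit_poly x)`_i = f c by apply: frob_fixed; rewrite -{2}fx coef_map.
by have := nc c; rewrite cE eqxx.
Qed.

Lemma min_poly_monic x : min_poly x \is monic.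
Proof. by rewrite -(map_monic f) map_min_poly monic_prod_XsubC. Qed.

Lemma size_min_poly x : size (min_poly x) = (fingraph.order frob x).+1.
Proof. by rewrite -(size_map_poly f) map_min_poly size_prod_XsubC size_orbit. Qed.

Lemma root_orbit_poly x y : root (orbit_poly x) y = (y \in fingraph.orbit frob x).
Proof. exact: root_prod_XsubC. Qed.

Lemma root_map_frob (q : {poly 'F_p}) y : root (map_poly f q) y -> root (map_poly f q) (frob y).
Proof.
move=> /eqP qy; apply/eqP.
have fq : map_poly (pFrobenius_aut chL) (map_poly f q) = map_poly f q.
  apply/polyP => i; rewrite !coef_map /= pFrobenius_autE -rmorphXn /=; congr (f _).
  by have := expf_card (q`_i); rewrite card_Fp.
rewrite -fq -[frob y]/(pFrobenius_aut chL y) horner_map /= qy.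
exact: pFrobenius_aut0.
Qed.

Lemma min_poly_dvd (q : {poly 'F_p}) x y : y \in fingraph.orbit frob x ->
  root (map_poly f q) y -> min_poly x %| q.
Proof.
move=> yx qy; rewrite -(dvdp_map f) map_min_poly.
apply: uniq_roots_dvdp; last by rewrite uniq_rootsE orbit_uniq.
apply/allP => z; rewrite -fconnect_orbit => xz.
have yz : fconnect frob y z.
  by apply: connect_trans xz; rewrite (fconnect_sym frob_inj) fconnect_orbit.
move/iter_findex: yz => <-.
elim: (findex _ _ _) => //= n; exact: root_map_frob.
Qed.

Lemma min_poly_irr x : irreducible_poly (min_poly x).
Proof.
split=> [|q sq qm]; first by rewrite size_min_poly ltnS fingraph.order_gt0.
have : map_poly f q %| orbit_poly x by rewrite -map_min_poly dvdp_map.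
move=> qo; have [y yx qy] : exists2 y, y \in fingraph.orbit frob x & root (map_poly f q) y.
  have [m mE] := dvdp_prod_XsubC qo.
  have sm : size (mask m (fingraph.orbit frob x)) != 0.
    apply: contra sq => /eqP s0; have := eqp_size mE.
    by rewrite size_map_poly size_prod_XsubC s0 => ->.
  case E : (mask m _) sm => [|y r] // _.
  exists y; first by apply: (mem_mask (m := m)); rewrite E mem_head.
  by rewrite (eqp_root mE) root_prod_XsubC E mem_head.
by rewrite /eqp qm (min_poly_dvd yx qy).
Qed.

Lemma mem_orbit_min_poly x y : (y \in fingraph.orbit frob x) = (min_poly y == min_poly x).
Proof.
apply/idP/eqP => [yx|E]; last first.
  by rewrite -root_orbit_poly -map_min_poly -E map_min_poly root_orbit_poly in_orbit.
have h a b : b \in fingraph.orbit frob a -> min_poly a %| min_poly b.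
  move=> ba; apply: (min_poly_dvd ba).
  by rewrite map_min_poly root_orbit_poly in_orbit.
apply/eqP; rewrite -eqp_monic ?min_poly_monic // /eqp (h _ _ yx) andbT h //.
by move: yx; rewrite -!fconnect_orbit (fconnect_sym frob_inj).
Qed.

(** Going nu times around Frobenius runs through the conjugates of x exactly r times; hence norms
    and traces from L are r-fold versions of those from the field generated by x. *)
Lemma traject_frob x : (0 < nu)%N -> exists r,
  traject frob x nu = flatten (nseq r (fingraph.orbit frob x)) /\ (nu = r * fingraph.order frob x)%N.
Proof.
move=> nu0; have E : traject frob x nu = x :: traject frob (frob x) nu.-1 by case: nu nu0.
have cyc : fcycle frob (x :: traject frob (frob x) nu.-1).
  by rewrite /= -[in X in rcons _ X](iter_frob_nu x) -[in X in iter X](prednK nu0) iterSr -trajectSr fpath_traject.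
have [r rE] := fcycle_consEflatten cyc; exists r.+1; rewrite E rE; split=> //.
have := congr1 size rE; rewrite -E size_traject size_flatten /shape map_nseq size_orbit sumn_nseq.
by rewrite mulnC.
Qed.

(** For e dividing nu the polynomial divides X^(p^e) - X, hence X^(p^nu) - X, which is the product
    of all X - x over L. Without a root in L it would be coprime to that product. *)
Lemma monic_irr_min_poly (e : nat) (v : 'rV['F_p]_e) : monic_irr v -> (e %| nu)%N ->
  exists x : L, monic_of v = min_poly x.
Proof.
move=> iv /dvdnP[r nuE]; have irr := (monic_irrP _ iv).
have [|nr] := boolP [exists x, root (map_poly f (monic_of v)) x].
  move=> /existsP[x rx]; exists x.
  have dv := min_poly_dvd (in_orbit frob x) rx.
  apply/esym/eqP; rewrite -eqp_monic ?min_poly_monic ?monic_of_monic //.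
  apply: irr.2 => //; rewrite size_min_poly eqSS -lt0n; exact: fingraph.order_gt0.
have dvX : map_poly f (monic_of v) %| \prod_(x : L) ('X - x%:P).
  have -> : \prod_(x : L) ('X - x%:P) = map_poly f ('X^(p ^ nu) - 'X).
    by rewrite -finField_genPoly cardL rmorphB /= map_polyXn map_polyX.
  rewrite dvdp_map nuE mulnC expnM.
  have := monic_irr_dvd_XqX iv; rewrite card_Fp //; set q := (p ^ e)%N => dv.
  elim: r {nuE} => [|r IHr]; first by rewrite expn0 expr1 subrr dvdp0.
  have -> : 'X^(q ^ r.+1) - 'X = ('X^(q ^ r) - 'X) ^+ q + ('X^q - 'X) :> {poly 'F_p}.
    have chX : p \in [pchar {poly 'F_p}] by rewrite pchar_poly pchar_Fp ?inE.
    by rewrite (exprDq e chX) (exprNq e chX) -exprM -expnSr addrA subrK.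
  rewrite dvdp_add // (dvdp_trans IHr) // -{1}['X^_ - 'X]expr1 dvdp_exp2l //.
  by rewrite expn_gt0 prime_gt0.
have cop : coprimep (map_poly f (monic_of v)) (\prod_(x : L) ('X - x%:P)).
  rewrite coprimep_sym; apply: (big_ind (fun q => coprimep q _)) => [|q1 q2|x _].
  - exact: coprime1p.
  - by rewrite coprimepMl => -> ->.
  - rewrite coprimep_sym coprimep_XsubC; move: nr; rewrite negb_exists => /forallP; exact.
rewrite coprimep_sym in cop; have := coprimepp (map_poly f (monic_of v)).
rewrite (coprimep_dvdr dvX cop) size_map_poly size_monic_of => /esym/eqP[e0].
by have := monic_irr_gt0 iv; rewrite lt0n => /eqP.
Qed.

End FrobeniusOrbits.

Section OrbitSums.
Variables (p nu : nat) (L : finFieldType) (f : {rmorphism 'F_p -> L}).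
Hypotheses (p_pr : prime p) (chL : p \in [pchar L]) (cardL : #|L| = (p ^ nu)%N).
Hypothesis nu_gt0 : (0 < nu)%N.
Local Notation frob := (@frob p L).
Local Notation min_poly := (min_poly f).
Local Notation order := (fingraph.order frob).

Let ord_dvd x : (order x %| nu)%N.
Proof. by have [r [_ ->]] := traject_frob cardL x nu_gt0; rewrite dvdn_mull. Qed.

(** An irreducible polynomial of degree e dividing nu is the minimal polynomial of exactly e
    elements of L, which absorbs the weight e. *)
Lemma prime_power_sum_orbits (C : comNzRingType) (lam : {poly 'F_p} -> C) :
  prime_power_sum lam nu = \sum_(x : L) lam (min_poly x) ^+ (nu %/ order x).
Proof.
transitivity (\sum_(1 <= e < nu.+1 | (e %| nu)%N) \sum_(v : 'rV['F_p]_e | monic_irr v)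
    \sum_(x : L | min_poly x == monic_of v) lam (min_poly x) ^+ (nu %/ order x)).
  rewrite /prime_power_sum; apply: eq_bigr => e enu; apply: eq_bigr => v iv.
  have [x0 vE] := monic_irr_min_poly f p_pr chL cardL iv enu.
  have ox0 : order x0 = e.
    by have := size_min_poly f p_pr chL x0; rewrite -vE size_monic_of => -[].
  have mE x : (min_poly x == monic_of v) = (x \in fingraph.orbit frob x0).
    by rewrite vE (mem_orbit_min_poly f p_pr chL).
  rewrite (eq_bigl _ _ mE) -big_uniq ?orbit_uniq //=.
  rewrite (eq_big_seq (fun=> lam (monic_of v) ^+ (nu %/ e))) => [|x xo].
    by rewrite big_const_seq count_predT size_orbit ox0 iter_addr_0 mulr_natl.
  have mx : min_poly x = monic_of v by apply/eqP; rewrite mE.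
  rewrite mx; congr (_ ^+ (_ %/ _)).
  by have := size_min_poly f p_pr chL x; rewrite mx size_monic_of => -[].
under eq_bigr do rewrite (exchange_big_dep xpredT) //=.
rewrite (exchange_big_dep xpredT) //=; apply: eq_bigr => x _.
have [v vE] := @monic_of_exists _ (order x) _ (min_poly_monic f p_pr chL x) (size_min_poly f p_pr chL x).
have iv : monic_irr v by apply/monic_irrP; rewrite -vE; exact: (min_poly_irr f p_pr chL).
rewrite big_mkcond /= (bigD1_seq (order x)) ?iota_uniq //=; last first.
  by rewrite mem_index_iota fingraph.order_gt0 ltnS dvdn_leq.
rewrite ord_dvd /= (big_pred1 v) => [|w]; last first.
  rewrite vE (inj_eq (@monic_of_inj _ _)) eq_sym andbC /=.
  by case: eqP => // ->; rewrite iv.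
rewrite big1_seq ?addr0 // => e /andP[ne _]; case: ifP => // _.
rewrite big1 // => w /andP[_ /eqP mE]; case/eqP: ne.
by have := size_min_poly f p_pr chL x; rewrite mE size_monic_of => -[].
Qed.

Lemma orbit_big (R : Type) (idx : R) (op : Monoid.law idx) (G : L -> R) x :
  \big[op/idx]_(0 <= j < nu) G (x ^+ (p ^ j)) =
  \big[op/idx]_(0 <= i < nu %/ order x) \big[op/idx]_(y <- fingraph.orbit frob x) G y.
Proof.
have [r [E nuE]] := traject_frob cardL x nu_gt0.
rewrite [in RHS]nuE mulnK ?fingraph.order_gt0 //.
transitivity (\big[op/idx]_(y <- traject frob x nu) G y).
  elim: nu => [|n IHn]; first by rewrite big_geq // big_nil.
  by rewrite trajectSr -cats1 big_cat big_seq1 big_nat_recr //= IHn iter_frob.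
rewrite E; elim: r {E nuE} => [|r IHr] /=; first by rewrite big_nil big_geq.
by rewrite big_cat /= IHr big_nat_recl.
Qed.

(** Both sides are the trace of g(x) from L to 'F_p, once over the conjugates of x and once as a sum
    of Frobenius powers. [eval_min_poly] is the same for norms. *)
Lemma root_trace_min_poly (g : {poly 'F_p}) x :
  f (root_trace g (min_poly x) *+ (nu %/ order x)) =
  \sum_(0 <= j < nu) (map_poly f g).[x] ^+ (p ^ j).
Proof.
transitivity (\sum_(0 <= j < nu) (map_poly f g).[x ^+ (p ^ j)]).
  rewrite (orbit_big _ (fun y => (map_poly f g).[y])) /=.
  rewrite big_const_nat subn0 iter_addr_0 rmorphMn /= -root_trace_map map_min_poly //.
  congr (_ *+ _); rewrite /orbit_poly; elim: (fingraph.orbit _ _) => [|y s IHs].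
    by rewrite !big_nil root_trace1.
  rewrite !big_cons root_traceM ?IHs ?root_trace_XsubC ?polyXsubC_eq0 //.
  by rewrite monic_neq0 // monic_prod_XsubC.
apply: eq_bigr => j _.
have chX : p \in [pchar {poly L}] by rewrite pchar_poly.
rewrite !horner_coef (expr_sumq j chL); apply: eq_bigr => i _.
rewrite exprMn -!exprM mulnC; congr (_ * _).
rewrite coef_map -rmorphXn /=; congr (f _).
elim: j => [|j IHj]; first by rewrite expn0 expr1.
by rewrite expnSr exprM -IHj; have := expf_card (g`_i); rewrite card_Fp.
Qed.

Lemma eval_min_poly (K : nat) (a : nat -> 'F_p) x :
  f ((\prod_(i < K) (min_poly x).[a i]) ^+ (nu %/ order x)) =
  \prod_(0 <= j < nu) (\prod_(i < K) (f (a i) - x)) ^+ (p ^ j).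
Proof.
rewrite rmorphXn rmorph_prod /= -prodrXl.
under [RHS]eq_bigr do rewrite -prodrXl.
rewrite [RHS]exchange_big /=; apply: eq_bigr => i _.
transitivity (\prod_(0 <= j < nu) (f (a i) - x ^+ (p ^ j))).
  rewrite (orbit_big _ (fun y => f (a i) - y)) /=.
  rewrite big_const_nat subn0 iter_mulr_1 -horner_map map_min_poly // /orbit_poly horner_prod.
  by congr (_ ^+ _); apply: eq_bigr => y _; rewrite hornerXsubC.
apply: eq_bigr => j _; rewrite (exprDq j chL) (exprNq j chL) -rmorphXn; congr (f _ - _).
elim: j => [|j IHj]; first by rewrite expn0 expr1.
by rewrite expnSr exprM -IHj; have := expf_card (a i); rewrite card_Fp.
Qed.

End OrbitSums.

(** One-sided bounds suffice. The deviations y_i = n_i m - #|T| are at most B, so |y_i| <= 2 B -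
    y_i, and their sum is at least - m E because the classes cover all but E elements. Since the
    weights sum to 0, only the deviations contribute. *)
Lemma equidistributed_class_sum (C : numFieldType) (T I : finType) (cls : T -> I) (P : pred I)
    (w : I -> C) (B E : nat) :
  (0 < #|P|)%N ->
  (forall i, P i -> #|[set x | cls x == i]| * #|P| <= #|T| + B)%N ->
  (#|[set x | ~~ P (cls x)]| <= E)%N ->
  (forall i, `|w i| <= 1) -> (forall i, ~~ P i -> w i = 0) -> \sum_(i | P i) w i = 0 ->
  `|\sum_x w (cls x)| <= (2 * B + E)%:R.
Proof.
move=> P0 cB cE w1 w0 sw.
pose n i := #|[set x | cls x == i]|; set m := #|P| in P0 cB *.
have sumE : \sum_x w (cls x) = \sum_(i | P i) w i * (n i)%:R.
  rewrite (bigID (fun x => P (cls x))) /= [X in _ + X]big1 ?addr0 => [|x /w0 //].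
  rewrite (partition_big cls P) //=; apply: eq_bigr => i Pi.
  rewrite (eq_bigr (fun=> w i)) => [|x /andP[_ /eqP ->] //].
  rewrite sumr_const mulr_natr /n; congr (_ *+ _); apply: eq_card => x.
  by rewrite inE unfold_in; apply: andb_idl => /eqP ->.
pose y i : C := (n i * m)%:R - #|T|%:R.
have sumy : m%:R * \sum_x w (cls x) = \sum_(i | P i) w i * y i.
  transitivity (\sum_(i | P i) w i * (n i * m)%:R - \sum_(i | P i) w i * #|T|%:R).
    rewrite -[X in _ - X]mulr_suml sw mul0r subr0 sumE mulr_sumr.
    by apply: eq_bigr => i _; rewrite natrM mulrCA [m%:R * _]mulrC.
  by rewrite -sumrB; apply: eq_bigr => i _; rewrite /y mulrBr.
have yB i : P i -> `|y i| <= (2 * B)%:R - y i.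
  move=> Pi; have yr : y i \is Num.real by rewrite rpredB ?realn.
  have yb : y i <= B%:R by rewrite lerBlDr -natrD ler_nat addnC cB.
  rewrite real_ler_norml // opprB lerBlDr; apply/andP; split.
    by rewrite lerDl ler0n.
  by rewrite lerBrDr natrM mulr_natl mulr2n lerD.
have sumn : (#|T| <= \sum_(i | P i) n i + E)%N.
  have -> : #|T| = (\sum_(i | P i) n i + #|[set x | ~~ P (cls x)]|)%N.
    rewrite -[LHS](cardC [pred x | P (cls x)]).
    congr (_ + _)%N; last by apply: eq_card => x; rewrite !inE.
    rewrite -sum1_card (partition_big cls P) //=; apply: eq_bigr => i Pi.
    rewrite sum1_card /n; apply: eq_card => x.
    by rewrite inE unfold_in; apply: andb_idl => /eqP Ei; rewrite inE /= Ei.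
  by rewrite leq_add2l.
have m0 : 0 < m%:R :> C by rewrite ltr0n.
rewrite -(ler_pM2l m0) -{1}[m%:R]normr_nat -normrM sumy.
apply: le_trans (ler_norm_sum _ _ _) _.
apply: le_trans (_ : \sum_(i | P i) ((2 * B)%:R - y i) <= _).
  apply: ler_sum => i Pi; rewrite normrM (le_trans _ (yB i Pi)) //.
  by rewrite ler_piMl.
rewrite sumrB sumr_const -/m /y sumrB sumr_const -/m -natr_sum -big_distrl /=.
rewrite opprB addrA lerBlDr -!mulrnA -natrM -!natrD ler_nat.
move: sumn; move: (#|T|) (\sum_(i | P i) n i)%N => t z tz.
by have := leq_mul tz (leqnn m); rewrite mulnDl mulnDr ![(m * _)%N]mulnC; lia.
Qed.

Lemma sum_nontrivial_mchar (k : finFieldType) (C : idomainType) (chi : k -> C) u :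
  (forall x y, chi (x * y) = chi x * chi y) -> u != 0 -> chi u != 1 ->
  \sum_(x | x != 0) chi x = 0.
Proof.
move=> chiM u0 chiu.
have : \sum_(x | x != 0) chi x = chi u * \sum_(x | x != 0) chi x.
  rewrite [in LHS](reindex_inj (mulfI u0)) /= mulr_sumr.
  by apply: eq_big => x; rewrite ?mulf_eq0 ?(negPf u0) // chiM.
move/eqP; rewrite -{1}[\sum_(x | _) _]mul1r -subr_eq0 -mulrBl mulf_eq0 subr_eq0.
by rewrite eq_sym (negPf chiu) => /eqP.
Qed.

Definition Fp_embed (p : nat) (L : nzRingType) (ch : p \in [pchar L]) (z : 'F_p) : L :=
  (nat_of_ord z)%:R.

Section FpEmbed.
Variables (p : nat) (L : nzRingType) (ch : p \in [pchar L]).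

Let natr_modp m : (m %% p)%:R = m%:R :> L.
Proof. by rewrite [in RHS](divn_eq m p) natrD natrM (pcharf0 ch) mulr0 add0r. Qed.

Let castE : (Zp_trunc (pdiv p)).+2 = p. Proof. exact: Fp_cast (pcharf_prime ch). Qed.

Fact Fp_embed_nmod : nmod_morphism (Fp_embed ch).
Proof.
split=> [|x y]; first by rewrite /Fp_embed.
by rewrite /Fp_embed /= -natrD -[RHS]natr_modp; congr (_%:R); rewrite /= [X in (_ %% X)%N]castE.
Qed.

Fact Fp_embed_monoid : monoid_morphism (Fp_embed ch).
Proof.
split=> [|x y]; first by rewrite /Fp_embed /= modn_small.
by rewrite /Fp_embed /= -natrM -[RHS]natr_modp; congr (_%:R); rewrite /= [X in (_ %% X)%N]castE.
Qed.

HB.instance Definition _ := GRing.isNmodMorphism.Build 'F_p L (Fp_embed ch) Fp_embed_nmod.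
HB.instance Definition _ := GRing.isMonoidMorphism.Build 'F_p L (Fp_embed ch) Fp_embed_monoid.
End FpEmbed.

(** * Power sums of even index, through norm and trace classes *)

Section ClassBound.
Variables (p K d : nat) (g : {poly 'F_p}).
Hypotheses (p_pr : prime p) (p_gt2 : (2 < p)%N) (K_gt0 : (0 < K)%N) (K_lep : (K <= p)%N).
Hypotheses (sg : size g = d.+1) (d_gt0 : (0 < d)%N) (d_ltp : (d < p)%N).

Let a (i : nat) : 'F_p := - i%:R.

Section FixedField.
Variables (mu : nat) (L : finFieldType) (f : {rmorphism 'F_p -> L}).
Hypotheses (chL : p \in [pchar L]) (cardL : #|L| = (p ^ (2 * mu))%N) (mu4 : (4 <= mu)%N).
Let Q := (p ^ mu)%N.

(* The norm of \prod_i (- i - x) and the trace of g at x. *)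
Definition frob_class (x : L) : 'F_p * 'F_p :=
  ((\prod_(i < K) (min_poly f x).[a i]) ^+ (2 * mu %/ fingraph.order (@frob p L) x),
   root_trace g (min_poly f x) *+ (2 * mu %/ fingraph.order (@frob p L) x)).

(** The factor i = 0 equals - 'X and provides the simple zero at 0 on which the valuations rest; the
    other factors do not vanish at 0 because K <= p. *)
Let h : {poly L} := \prod_(i < K) ((f (a i))%:P - 'X).
Let h1 : {poly L} := - \prod_(i < K.-1) ((f (a i.+1))%:P - 'X).

Let nu_gt0 : (0 < 2 * mu)%N. Proof. by case: mu mu4. Qed.

Let h_horner x : h.[x] = \prod_(i < K) (f (a i) - x).
Proof. by rewrite horner_prod; apply: eq_bigr => i _; rewrite !hornerE. Qed.

Let hE : h = 'X * h1.
Proof.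
rewrite /h /h1; case: K K_gt0 => // k _; rewrite big_ord_recl /= mulrN -mulNr.
by congr (_ * _); rewrite /a oppr0 rmorph0 sub0r.
Qed.

Let h1_0 : h1.[0] != 0.
Proof.
rewrite hornerN oppr_eq0 horner_prod; apply/prodf_neq0 => i _.
rewrite !hornerE subr0 fmorph_eq0 /a oppr_eq0 -(dvdn_pcharf (pchar_Fp p_pr)).
rewrite gtnNdvd // (leq_trans _ K_lep) //.
by have := ltn_ord i; rewrite -ltnS prednK.
Qed.

Let sh : size h = K.+1.
Proof.
rewrite /h; elim: K => [|m IHm]; first by rewrite big_ord0 size_poly1.
rewrite big_ord_recr /= -(opprB 'X) mulrN size_polyN size_Mmonic ?monicXsubC //.
  by rewrite IHm size_XsubC addn2.
by rewrite -size_poly_eq0 IHm.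
Qed.

Let sum_pX : ((p ^ mu).-1 %/ p.-1 * Q.+1 = \sum_(0 <= j < 2 * mu) p ^ j)%N.
Proof.
have p1 : (0 < p.-1)%N by rewrite -ltnS prednK //; lia.
apply/eqP; rewrite -(eqn_pmul2l p1) big_mkord -predn_exp mulnA [(p.-1 * _)%N]mulnC divnK; last first.
  by rewrite predn_exp dvdn_mulr.
rewrite [(2 * mu)%N]mulnC expnM -/Q; have : (0 < Q)%N by rewrite expn_gt0 prime_gt0.
by case: Q => // q _; apply/eqP; rewrite -mulnn /=; nia.
Qed.

Let class_subset u t x : frob_class x = (u, t) ->
  (frob_norm_poly p mu h).[x] ^+ Q.+1 = f u /\
  (frob_trace_poly p mu (map_poly f g)).[x] + (frob_trace_poly p mu (map_poly f g)).[x] ^+ Q = f t.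
Proof.
move=> [<- <-]; split.
  rewrite (eval_min_poly f p_pr chL cardL nu_gt0) /frob_norm_poly horner_exp -exprM sum_pX.
  rewrite -h_horner; elim/big_ind2: _ => //= [m1 y1 m2 y2 <- <-].
  by rewrite exprD.
rewrite (root_trace_min_poly f p_pr chL cardL nu_gt0) /frob_trace_poly horner_sum (expr_sumq mu chL).
rewrite mul2n -addnn (big_cat_nat (n := mu)) ?leq_addr //= big_mkord; congr (_ + _).
  by apply: eq_bigr => i _; rewrite horner_exp.
rewrite -[X in _ = \sum_(X <= _ < _) _]add0n big_addn addnK big_mkord; apply: eq_bigr => i _.
by rewrite horner_exp -exprM -expnD.
Qed.

(** There are (p - 1) p classes of nonzero norm; norm 0 occurs only at the at most K roots of h. The
    weights sum to 0 because chi is nontrivial. *)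
Lemma frob_class_sum (C : numFieldType) (chi psi : 'F_p -> C) u :
  (2 * stepanov_defect p K d + 2 <= Q)%N ->
  (forall x y, chi (x * y) = chi x * chi y) -> chi 0 = 0 -> u != 0 -> chi u != 1 ->
  (forall x, `|chi x| <= 1) -> (forall x, `|psi x| <= 1) ->
  `|\sum_x chi (frob_class x).1 * psi (frob_class x).2| <=
    ((2 * (p.-1 * p * (stepanov_defect p K d + K + d + 1)) + K) * Q)%:R.
Proof.
move=> QC chiM chi0 u0 chiu chi_le psi_le.
set B := (Q * (p.-1 * p * (stepanov_defect p K d + K + d + 1)))%N.
have Q0 : (0 < Q)%N by rewrite expn_gt0 prime_gt0.
apply: le_trans (_ : (2 * B + K)%:R <= _); last first.
  by rewrite ler_nat mulnDl /B [(Q * _)%N]mulnC mulnA leq_add2l leq_pmulr.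
have cardP : #|[pred i : 'F_p * 'F_p | i.1 != 0]| = (p.-1 * p)%N.
  transitivity #|[predX predC1 (0 : 'F_p) & (predT : pred 'F_p)]|.
    by apply: eq_card => -[i j]; rewrite !inE /= andbT.
  by rewrite cardX cardC1 card_Fp // cardT -cardE card_Fp.
apply: (@equidistributed_class_sum C L _ frob_class [pred i | i.1 != 0]
  (fun i => chi i.1 * psi i.2) B K).
- by rewrite cardP muln_gt0 (prime_gt0 p_pr) andbT -ltnS prednK ?(prime_gt0 p_pr) // prime_gt1.
- move=> [w t] /= w0; rewrite cardP.
  have fw0 : f w != 0 by rewrite fmorph_eq0.
  have cardL2 : #|L| = (Q ^ 2)%N by rewrite cardL mulnC expnM.
  have sfg : size (map_poly f g) = d.+1 by rewrite size_map_poly.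
  have := stepanov_class_bound chL p_gt2 mu4 cardL2 hE h1_0 sh sfg d_gt0 d_ltp (f t) fw0 QC.
  rewrite -/B -cardL2; apply: leq_trans; rewrite leq_mul2r; apply/orP; right.
  apply/subset_leq_card/fintype.subsetP => x; rewrite !inE => /eqP /class_subset[-> ->].
  by rewrite !eqxx.
- have sub : [set x | ~~ [pred i | i.1 != 0] (frob_class x)] \subset [set f (a i) | i : 'I_K].
    apply/fintype.subsetP => x; rewrite !inE /= negbK => /eqP c0.
    have := eval_min_poly f p_pr chL cardL nu_gt0 K a x.
    rewrite c0 rmorph0 => /esym/eqP.
    rewrite prodf_seq_eq0 => /hasP[j _ /=]; rewrite expf_eq0 => /andP[_].
    rewrite prodf_seq_eq0 => /hasP[i _ /=]; rewrite subr_eq0 => /eqP <-.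
    by apply/imsetP; exists i.
  by rewrite (leq_trans (subset_leq_card sub)) // (leq_trans (leq_imset_card _ _)) // card_ord.
- by move=> i; rewrite normrM mulr_ile1.
- by move=> i /=; rewrite negbK => /eqP ->; rewrite chi0 mul0r.
transitivity (\sum_(i | i != 0) \sum_j chi i * psi j).
  rewrite pair_big /=; apply: eq_big => [[i j]|[i j] _] //=; by rewrite andbT.
under eq_bigr do rewrite -mulr_sumr.
by rewrite -mulr_suml (sum_nontrivial_mchar chiM u0 chiu) mul0r.
Qed.

End FixedField.
End ClassBound.

Section ExtensionSums.
Variables (p K : nat) (g : {poly 'F_p}).
Hypotheses (p_pr : prime p) (p_gt2 : (2 < p)%N) (K_gt0 : (0 < K)%N) (K_lep : (K <= p)%N).
Hypothesis sg : (size g <= p)%N.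

Lemma mixed_prime_power_sum_bound : exists c mu0 : nat, forall (mu : nat), (mu0 <= mu)%N ->
  forall (C : numFieldType) (chi psi : 'F_p -> C) u,
  chi 1 = 1 -> (forall x y, chi (x * y) = chi x * chi y) -> chi 0 = 0 -> u != 0 -> chi u != 1 ->
  psi 0 = 1 -> (forall x y, psi (x + y) = psi x * psi y) ->
  (forall x, `|chi x| <= 1) -> (forall x, `|psi x| <= 1) ->
  `|prime_power_sum (mixed_lam chi psi K (fun i => - i%:R) g) (2 * mu)| <= (c * p ^ mu)%:R.
Proof.
have p_gt0 := prime_gt0 p_pr.
(* The class bound needs positive degree. For constant g the psi factor does not depend on x, and
   the bound is applied to g' = 'X with psi replaced by 1. *)
pose g' := if (1 < size g)%N then g else 'X.
pose d := (size g').-1.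
have [d_gt0 d_ltp] : (0 < d)%N /\ (d < p)%N.
  rewrite /d /g'; case: ifP => s1; last by rewrite size_polyX /=; split=> //; apply: ltnW.
  by case: (size g) s1 sg => [|[|n]].
have sg' : size g' = d.+1 by move: d_gt0; rewrite /d; case: (size g').
exists (2 * (p.-1 * p * (stepanov_defect p K d + K + d + 1)) + K)%N.
exists (4 + 2 * stepanov_defect p K d + 2)%N => mu mu_ge C chi psi u chi1 chiM chi0 u0 chiu psi0 psiD chi_le psi_le.
have mu4 : (4 <= mu)%N by lia.
have nu0 : (0 < 2 * mu)%N by lia.
have [L chL cardL] := pPrimePowerField p_pr nu0.
pose f : {rmorphism 'F_p -> L} := Fp_embed chL.
have QC : (2 * stepanov_defect p K d + 2 <= p ^ mu)%N.
  rewrite (leq_trans _ (ltnW (ltn_expl mu (prime_gt1 p_pr)))) //; lia.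
rewrite (prime_power_sum_orbits f p_pr chL cardL nu0).
pose r x := (2 * mu %/ fingraph.order (@frob p L) x)%N.
have chiX (x : 'F_p) n : chi x ^+ n = chi (x ^+ n).
  by elim: n => [|n IHn]; rewrite ?expr0 ?chi1 // !exprS IHn chiM.
have psiX (x : 'F_p) n : psi x ^+ n = psi (x *+ n).
  by elim: n => [|n IHn]; [rewrite expr0 mulr0n psi0 | rewrite exprS IHn mulrS psiD].
have bnd := frob_class_sum p_pr p_gt2 K_gt0 K_lep sg' d_gt0 d_ltp f chL cardL mu4 QC chiM chi0 u0 chiu chi_le.
rewrite (eq_bigr (fun x => chi ((\prod_(i < K) (min_poly f x).[- i%:R]) ^+ r x) *
    psi (root_trace g (min_poly f x) *+ r x))); last first.
  by move=> x _; rewrite /mixed_lam exprMn chiX psiX.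
have [s1|s1] := ltnP 1 (size g).
  have gE : g' = g by rewrite /g' s1.
  by have := bnd psi psi_le; rewrite /frob_class gE.
have rt x : root_trace g (min_poly f x) *+ r x = root_trace g (min_poly f 0) *+ r 0.
  apply: (fmorph_inj f); rewrite !(root_trace_min_poly f p_pr chL cardL nu0).
  by apply: eq_bigr => j _; rewrite (size1_polyC s1) map_polyC !hornerC.
under eq_bigr do rewrite rt.
rewrite -mulr_suml normrM (le_trans (ler_piMr _ (psi_le _))) //.
have /= := bnd (fun=> 1) (fun=> _); rewrite normr1 => /(_ (fun=> lexx _)).
by under eq_bigr do rewrite mulr1.
Qed.

End ExtensionSums.

(** * From power sums to the Weil bound *)

Section PowerSums.
Variable C : numClosedFieldType.

Definition psum (s : seq C) (n : nat) : C := \sum_(w <- s) w ^+ n.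

(** This is - X L'/L = sum over w and v >= 1 of (w X)^v, multiplied out and truncated so as to
    remain a statement on polynomials. *)
Lemma newton_prod_dvd (s : seq C) n : let L := \prod_(w <- s) (1 - w *: 'X) in
  'X^(n.+1) %| 'X * L^`() + L * \sum_(1 <= v < n.+1) psum s v *: 'X^v.
Proof.
elim: s => [|w s IHs] /=.
  rewrite big_nil derivC mulr0 add0r mul1r big1 ?dvdp0 // => v _.
  by rewrite /psum big_nil scale0r.
rewrite !big_cons; move: IHs => /=; set L := \prod_(_ <- _) _ => IHs.
set P := \sum_(1 <= v < n.+1) psum s v *: 'X^v in IHs.
have -> : \sum_(1 <= v < n.+1) psum (w :: s) v *: 'X^v = P + \sum_(1 <= v < n.+1) w ^+ v *: 'X^v.
  by rewrite -big_split /=; apply: eq_bigr => v _; rewrite /psum big_cons addrC scalerDl.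
set W := \sum_(1 <= v < n.+1) w ^+ v *: 'X^v.
have WE : (1 - w *: 'X) * W = w *: 'X - w ^+ n.+1 *: 'X^(n.+1).
  rewrite /W; elim: (n) => [|m IHm]; first by rewrite big_geq // mulr0 !expr1 subrr.
  rewrite big_nat_recr //= mulrDr IHm mulrBl mul1r.
  by rewrite -scalerAl -scalerAr scalerA -!exprS addrA subrK.
have -> : 'X * ((1 - w *: 'X) * L)^`() + (1 - w *: 'X) * L * (P + W) =
  (1 - w *: 'X) * ('X * L^`() + L * P) + L * (- (w ^+ n.+1 *: 'X^(n.+1))).
  rewrite derivM derivB derivC derivZ derivX.
  have -> : - (w ^+ n.+1 *: 'X^(n.+1)) = (1 - w *: 'X) * W - w *: 'X by rewrite WE addrAC subrr add0r.
  by rewrite -[w *: 1]mul_polyC -![w *: 'X]mul_polyC; ring.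
by rewrite dvdp_add // dvdp_mull // -scaleNr -mul_polyC dvdp_mull.
Qed.

(** The A n are the coefficients of a polynomial L of degree below D with L(0) = 1; s lists the
    inverses of its roots. As A 0 = 1, the recursion determines S from A, and [newton_prod_dvd]
    shows that - psum s satisfies it too. *)
Lemma newton_roots (A S : nat -> C) D : (0 < D)%N -> A 0 = 1 -> (forall n, (D <= n)%N -> A n = 0) ->
  (forall n, n%:R * A n = \sum_(1 <= v < n.+1) S v * A (n - v)%N) ->
  exists2 s : seq C, (size s < D)%N & forall v, (0 < v)%N -> S v = - psum s v.
Proof.
move=> D0 A0 AD newton; pose L := \poly_(n < D) A n.
have LE n : L`_n = A n by rewrite coef_poly; case: ltnP => // /AD.
have L00 : L.[0] = 1 by rewrite horner_coef0 LE.
have L0 : L != 0 by apply: contra_eq_neq L00 => ->; rewrite horner0 eq_sym oner_neq0.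
have [r Lr] := closed_field_poly_normal L.
have r0 z : z \in r -> z != 0.
  move=> zr; apply/eqP => z0; rewrite z0 in zr.
  have : root (\prod_(z <- r) ('X - z%:P)) 0 by rewrite root_prod_XsubC.
  move=> /eqP rz; have /eqP := L00; rewrite Lr hornerZ rz mulr0 eq_sym.
  by rewrite oner_eq0.
pose s := map GRing.inv r; exists s.
  rewrite size_map; have : size L = (size r).+1.
    by rewrite Lr size_scale ?lead_coef_eq0 // size_prod_XsubC.
  by move=> sL; rewrite -ltnS -sL ltnS size_poly.
have LE2 : L = \prod_(w <- s) (1 - w *: 'X).
  have : L = (lead_coef L * \prod_(z <- r) (- z)) *: \prod_(w <- s) (1 - w *: 'X).
    rewrite {1}Lr -scalerA; congr (_ *: _); rewrite /s big_map.
    rewrite -scaler_prod; apply: eq_big_seq => z zr.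
    by rewrite scaleNr scalerBr scalerA mulfV ?r0 // scale1r opprB alg_polyC.
  move=> E; have : lead_coef L * \prod_(z <- r) (- z) = 1.
    have := congr1 (fun q : {poly C} => q.[0]) E; rewrite L00 hornerZ horner_prod.
    by rewrite [X in _ * X]big1 ?mulr1 // => w _; rewrite !hornerE ?mulr0 ?subr0.
  by move=> E1; rewrite {1}E E1 scale1r.
have key n : n%:R * A n + \sum_(1 <= v < n.+1) psum s v * A (n - v)%N = 0.
  have := newton_prod_dvd s n; rewrite /= -LE2 => /dvdpP[q qE].
  have := congr1 (fun q : {poly C} => q`_n) qE.
  rewrite coefMXn ltnSn coefD coefXM coef_deriv mulr_sumr coef_sum => E0; rewrite -[RHS]E0; congr (_ + _).
    by case: n {qE q E0} => [|n] /=; rewrite ?mul0r // LE mulr_natl.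
  apply: eq_big_nat => v /andP[_ vn]; rewrite -scalerAr coefZ coefMXn ltnNge -ltnS vn /= LE.
  by [].
elim/ltn_ind => v IHv v0.
have /eqP := key v; rewrite newton -big_split /= big_nat_recr //= big_nat big1 ?add0r.
  by rewrite subnn A0 !mulr1 addr_eq0 => /eqP.
by move=> i /andP[i1 iv]; rewrite IHv // mulNr addNr.
Qed.

Hypothesis arch : forall x : C, 0 <= x -> exists n : nat, x < n%:R.

Lemma bounded_powers_le1 (x M : C) n0 : 0 <= x -> (forall n, (n0 <= n)%N -> x ^+ n <= M) -> x <= 1.
Proof.
move=> x0 xM; rewrite real_leNgt ?ger0_real ?ler01 //; apply/negP => x1.
have M0 : 0 <= M by apply: le_trans (xM n0 (leqnn _)); rewrite exprn_ge0.
have y0 : 0 < x - 1 by rewrite subr_gt0.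
have bern n : 1 + n%:R * (x - 1) <= x ^+ n.
  elim: n => [|n IHn]; first by rewrite mul0r addr0 expr0.
  rewrite exprS; apply: le_trans (ler_wpM2l x0 IHn).
  have -> : x * (1 + n%:R * (x - 1)) = 1 + n.+1%:R * (x - 1) + n%:R * (x - 1) ^+ 2.
    by rewrite -natr1; ring.
  by rewrite lerDl mulr_ge0 // exprn_ge0 // ltW.
have [n nM] := arch (divr_ge0 M0 (ltW y0)).
rewrite ltr_pdivrMr // in nM.
have : n%:R * (x - 1) <= M.
  apply: le_trans (le_trans (bern (n0 + n)%N) (xM _ (leq_addr _ _))).
  rewrite natrD mulrDl addrA lerDr addr_ge0 // mulr_ge0 // ltW //.
by move/(lt_le_trans nM); rewrite ltxx.
Qed.

(* A combination of shifts of psum s kills all the terms but those of w. *)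
Lemma power_sum_bound (s : seq C) (c : C) (q : nat) n0 : (0 < q)%N ->
  (forall n, (n0 <= n)%N -> `|psum s n| <= c * q%:R ^+ n) -> forall w, w \in s -> `|w| <= q%:R.
Proof.
move=> q0 sc w0 w0s.
have q0' : 0 < q%:R :> C by rewrite ltr0n.
pose P := \prod_(v <- undup s | v != w0) ('X - v%:P).
pose ka := (count_mem w0 s)%:R * P.[w0].
have ka0 : ka != 0.
  rewrite mulf_neq0 ?pnatr_eq0 -?lt0n -?has_count ?has_pred1 //.
  rewrite horner_prod prodf_seq_neq0; apply/allP => v _; apply/implyP => vw.
  by rewrite hornerXsubC subr_eq0 eq_sym.
have key n : \sum_(j < size P) P`_j * psum s (n + j) = ka * w0 ^+ n.
  transitivity (\sum_(w <- s) w ^+ n * P.[w]).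
    under eq_bigr do rewrite /psum mulr_sumr.
    rewrite exchange_big /=; apply: eq_bigr => w _.
    rewrite horner_coef mulr_sumr; apply: eq_bigr => j _.
    by rewrite exprD mulrCA.
  rewrite (bigID (pred1 w0)) /= [X in _ + X]big1_seq ?addr0 => [|w /andP[ww ws]].
    rewrite (eq_bigr (fun=> w0 ^+ n * P.[w0])) => [|w /eqP -> //].
    by rewrite big_const_seq iter_addr_0 -mulr_natl /ka mulrCA mulrC -!mulrA.
  rewrite [P.[w]](_ : _ = 0) ?mulr0 // /P (big_rem w) ?mem_undup //= ww.
  by rewrite hornerM hornerXsubC subrr mul0r.
pose M := \sum_(j < size P) `|P`_j| * (c * q%:R ^+ j).
have bnd n : (n0 <= n)%N -> (`|w0| / q%:R) ^+ n <= M / `|ka|.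
  move=> nn; rewrite ler_pdivlMr ?normr_gt0 // expr_div_n mulrAC ler_pdivrMr ?exprn_gt0 //.
  rewrite mulrC -normrX -normrM -key (le_trans (ler_norm_sum _ _ _)) // /M mulr_suml.
  apply: ler_sum => j _; rewrite normrM -mulrA ler_wpM2l // (le_trans (sc _ _)) ?(leq_trans nn) ?leq_addr //.
  by rewrite exprD -!mulrA [q%:R ^+ n * _]mulrC.
have := bounded_powers_le1 _ bnd; rewrite divr_ge0 // => /(_ isT).
by rewrite ler_pdivrMr // mul1r.
Qed.

(** Only even indices are controlled, so [power_sum_bound] is applied to the squares of the inverse
    roots and gives |w^2| <= p. Then A 1 = S 1 is minus a sum of at most D - 1 of the w. *)
Lemma newton_bound (A S : nat -> C) D (c p mu0 : nat) :
  (0 < D)%N -> (0 < p)%N -> A 0 = 1 -> (forall n, (D <= n)%N -> A n = 0) ->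
  (forall n, n%:R * A n = \sum_(1 <= v < n.+1) S v * A (n - v)%N) ->
  (forall mu, (mu0 <= mu)%N -> `|S (2 * mu)%N| <= (c * p ^ mu)%:R) ->
  `|A 1| <= D.-1%:R * sqrtC p%:R.
Proof.
move=> D0 p0 A0 AD newton Sb.
have [s sD SE] := newton_roots D0 A0 AD newton.
have wb w : w \in s -> `|w| <= sqrtC p%:R.
  move=> ws; rewrite -(@ler_pXn2r _ 2) ?nnegrE ?sqrtC_ge0 ?ler0n // sqrtCK -normrX.
  apply: (@power_sum_bound (map (fun w => w ^+ 2) s) c%:R p mu0.+1) => //; last exact: map_f.
  move=> n n0; have -> : psum [seq w ^+ 2 | w <- s] n = - S (2 * n)%N.
    rewrite SE ?muln_gt0 ?(leq_trans _ n0) // opprK /psum big_map.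
    by apply: eq_bigr => v _; rewrite exprM.
  by rewrite normrN -natrX -natrM Sb // ltnW.
have -> : A 1 = - psum s 1.
  by rewrite -SE //; have := newton 1; rewrite mul1r big_nat1 A0 mulr1.
rewrite normrN /psum (le_trans (ler_norm_sum _ _ _)) //.
apply: le_trans (_ : \sum_(w <- s) sqrtC p%:R <= _).
  by rewrite !big_seq; apply: ler_sum => w ws; rewrite expr1 wb.
rewrite big_const_seq count_predT iter_addr_0 -[X in X <= _]mulr_natl ler_wpM2r ?sqrtC_ge0 ?ler0n // ler_nat.
by rewrite -ltnS prednK.
Qed.

End PowerSums.

Theorem weil_mixed_sum (C : numClosedFieldType) (p K d : nat) (g : {poly 'F_p})
    (chi psi : 'F_p -> C) u :
  (forall x : C, 0 <= x -> exists n : nat, x < n%:R) ->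
  prime p -> (2 < p)%N -> (0 < K <= p)%N -> (d < p)%N -> (size g <= d.+1)%N ->
  chi 1 = 1 -> (forall x y, chi (x * y) = chi x * chi y) -> chi 0 = 0 -> u != 0 -> chi u != 1 ->
  psi 0 = 1 -> (forall x y, psi (x + y) = psi x * psi y) ->
  (forall x, `|chi x| <= 1) -> (forall x, `|psi x| <= 1) ->
  `|\sum_x chi (\prod_(i < K) (x + i%:R)) * psi g.[x]| <= (K + d)%:R * sqrtC p%:R.
Proof.
move=> arch p_pr p2 /andP[K0 Kp] dp sg chi1 chiM chi0 u0 chiu psi0 psiD chi_le psi_le.
have p0 := prime_gt0 p_pr.
pose a (i : nat) : 'F_p := - i%:R.
have ainj i : (0 < i < K)%N -> a i != a 0.
  move=> /andP[i0 iK]; rewrite /a oppr0 oppr_eq0 -(dvdn_pcharf (pchar_Fp p_pr)).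
  by rewrite gtnNdvd // (leq_trans iK).
have chiT : exists2 u, u != 0 & chi u != 1 by exists u.
have sgp : (size g <= p)%N by rewrite (leq_trans sg).
have [c [mu0 bnd]] := mixed_prime_power_sum_bound p_pr p2 K0 Kp sgp.
have lam1 := mixed_lam1 chi1 psi0 K a g.
have lamM := mixed_lamM chiM psiD K a g.
have D0 : (0 < K + d)%N by rewrite addn_gt0 K0.
pose lam := mixed_lam chi psi K a g.
have : `|L_coef lam 1| <= (K + d).-1%:R * sqrtC p%:R.
  apply: (@newton_bound C arch (L_coef lam) (prime_power_sum lam) (K + d) c p mu0) => //.
  - exact: mixed_L_coef0.
  - by move=> n Kdn; apply: (mixed_L_coef_eq0 psi chiM K0 sg ainj chiT).
  - exact: L_coef_newton.
  - by move=> mu hmu; apply: (bnd mu hmu C chi psi u).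
rewrite mixed_L_coef1 => h.
have -> : \sum_x chi (\prod_(i < K) (x + i%:R)) * psi g.[x] =
    chi ((-1) ^+ K) * \sum_x chi (\prod_(i < K) (a i - x)) * psi g.[x].
  rewrite mulr_sumr; apply: eq_bigr => x _; rewrite mulrA -chiM; congr (chi _ * _).
  rewrite -[in X in _ ^+ X](card_ord K) -prodr_const -big_split /=.
  by apply: eq_bigr => i _; rewrite /a mulN1r opprB opprK.
rewrite normrM (le_trans (ler_piMl _ (chi_le _))) // (le_trans h) //.
by rewrite ler_wpM2r ?sqrtC_ge0 ?ler0n // ler_nat leq_pred.
Qed.

(** * Incomplete sums and factorials *)

Section VanDerCorput.
Variable C : numClosedFieldType.

Lemma norm_sum_sqr (n : nat) (z : nat -> C) :
  `|\sum_(i < n) z i| ^+ 2 <= n%:R * \sum_(i < n) `|z i| ^+ 2.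
Proof.
apply: le_trans (_ : (\sum_(i < n) `|z i|) ^+ 2 <= _).
  by rewrite lerXn2r ?nnegrE ?normr_ge0 ?sumr_ge0 // ler_norm_sum.
have n2 : 0 < 2%:R :> C by rewrite ltr0n.
rewrite -(ler_pM2l n2) expr2 mulr_suml mulr_sumr.
have -> : 2%:R * (n%:R * \sum_(i < n) `|z i| ^+ 2) =
    \sum_(i < n) \sum_(j < n) (`|z i| ^+ 2 + `|z j| ^+ 2).
  under [RHS]eq_bigr do rewrite big_split /= sumr_const card_ord.
  rewrite big_split /= sumr_const card_ord sumrMnl.
  by rewrite mulr_natl mulr2n mulr_natl.
apply: ler_sum => i _; rewrite mulr_sumr mulr_sumr; apply: ler_sum => j _.
rewrite -subr_ge0.
have -> : `|z i| ^+ 2 + `|z j| ^+ 2 - 2%:R * (`|z i| * `|z j|) = (`|z i| - `|z j|) ^+ 2 by ring.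
by rewrite real_exprn_even_ge0 // rpredB ?normr_real.
Qed.

Lemma van_der_corput (a : nat -> C) (N K : nat) (B : C) :
  (0 < K <= N)%N -> 0 <= B -> (forall n, `|a n| <= 1) ->
  (forall j, (0 < j < K)%N -> `|\sum_(i < N - j) a (i + j)%N * (a i)^*| <= B) ->
  `|\sum_(i < N) a i| ^+ 2 * K%:R <= 2%:R * N%:R * (N%:R + K%:R * B).
Proof.
move=> /andP[K0 KN] B0 a1 aB.
(* The sequence moved right by K and extended by 0: every window n + k with n < N + K and k <= K is
   then a natural number range containing the whole support. *)
pose b m := if (K <= m < K + N)%N then a (m - K)%N else 0.
set T := \sum_(i < N) a i.
have shiftE (G : nat -> C) k : (k <= K)%N -> (forall m, ~~ (K <= m < K + N)%N -> G m = 0) ->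
    \sum_(n < N + K) G (n + k)%N = \sum_(i < N) G (i + K)%N.
  move=> kK G0; rewrite -(big_mkord xpredT (fun n => G (n + k)%N)).
  rewrite -(big_mkord xpredT (fun n => G (n + K)%N)).
  rewrite (big_cat_nat (n := (K - k)%N)) //=; last lia.
  rewrite big_nat_cond big1 ?add0r => [|i /andP[/andP[_ ik] _]]; last first.
    by rewrite G0 //; lia.
  rewrite (big_cat_nat (n := (N + K - k)%N)) ?leq_subr //=; last lia.
  rewrite [X in _ + X]big_nat_cond [X in _ + X]big1 ?addr0 => [|i /andP[/andP[ik _] _]]; last first.
    by rewrite G0 //; lia.
  rewrite -{1}[(K - k)%N]add0n big_addn.
  have -> : (N + K - k - (K - k) = N)%N by lia.
  by apply: eq_big_nat => i _; congr G; lia.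
have KT : K%:R * T = \sum_(n < N + K) \sum_(k < K) b (n + k)%N.
  rewrite exchange_big /= (eq_bigr (fun=> T)) => [|k _].
    by rewrite sumr_const card_ord mulr_natl.
  rewrite shiftE ?(ltnW (ltn_ord k)) // => [|m /negPf mN]; last by rewrite /b mN.
  by apply: eq_bigr => i _; rewrite /b leq_addl addnC ltn_add2l ltn_ord addKn.
have K0' : 0 < K%:R :> C by rewrite ltr0n.
have corr k k' : (k < k')%N -> (k' < K)%N ->
    `|\sum_(n < N + K) b (n + k')%N * (b (n + k)%N)^*| <= B.
  move=> kk' k'K; have jK : (0 < k' - k < K)%N by lia.
  apply: le_trans (aB _ jK); rewrite le_eqVlt; apply/orP; left; apply/eqP; congr `|_|.
  pose G m := b (m + (k' - k))%N * (b m)^*.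
  transitivity (\sum_(n < N + K) G (n + k)%N).
    by apply: eq_bigr => n _; rewrite /G; congr (b _ * _); lia.
  rewrite shiftE => [||m /negPf mN]; [|lia|by rewrite /G /b mN rmorph0 mulr0].
  rewrite -(big_mkord xpredT (fun i => G (i + K)%N)).
  rewrite (big_cat_nat (n := (N - (k' - k))%N)) ?leq_subr //= [X in _ + X]big_nat_cond.
  rewrite [X in _ + X]big1 ?addr0 => [|i /andP[/andP[ik iN] _]]; last first.
    rewrite /G /b; have -> : (K <= i + K + (k' - k) < K + N)%N = false by lia.
    by rewrite mul0r.
  rewrite big_mkord; apply: eq_bigr => i _; have iN := ltn_ord i.
  rewrite /G /b; have -> : (K <= i + K + (k' - k) < K + N)%N by lia.
  have -> : (K <= i + K < K + N)%N by lia.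
  by congr (a _ * (a _)^*); lia.
(* For each k, the diagonal term contributes at most N and the K - 1 others at most B each. *)
have bound : \sum_(n < N + K) `|\sum_(k < K) b (n + k)%N| ^+ 2 <= K%:R * (N%:R + K%:R * B).
  have sqE : \sum_(n < N + K) `|\sum_(k < K) b (n + k)%N| ^+ 2 =
      \sum_(k < K) \sum_(k' < K) \sum_(n < N + K) b (n + k)%N * (b (n + k')%N)^*.
    rewrite [RHS](eq_bigr (fun k : 'I_K => \sum_(n < N + K) \sum_(k' < K) b (n + k)%N * (b (n + k')%N)^*)); last first.
      by move=> k _; apply: exchange_big.
    rewrite [RHS]exchange_big /=; apply: eq_bigr => n _.
    rewrite normCK rmorph_sum /= mulr_suml; apply: eq_bigr => k _.
    by rewrite mulr_sumr.
  have ge0 : 0 <= \sum_(k < K) \sum_(k' < K) \sum_(n < N + K) b (n + k)%N * (b (n + k')%N)^*.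
    rewrite -sqE; apply: sumr_ge0 => n _; exact: exprn_ge0.
  rewrite sqE -(ger0_norm ge0) (le_trans (ler_norm_sum _ _ _)) //.
  apply: le_trans (_ : \sum_(k < K) (N%:R + K%:R * B) <= _); last first.
    by rewrite sumr_const card_ord -[X in X <= _]mulr_natl.
  apply: ler_sum => k _; rewrite (le_trans (ler_norm_sum _ _ _)) //.
  rewrite (bigD1 k) //= lerD //.
    rewrite (le_trans (ler_norm_sum _ _ _)) //.
    pose G m := `|b m * (b m)^*|.
    rewrite (shiftE G) ?(ltnW (ltn_ord k)) // => [|m /negPf mN]; last by rewrite /G /b mN mul0r normr0.
    apply: le_trans (_ : \sum_(i < N) 1 <= _); last by rewrite sumr_const card_ord.
    apply: ler_sum => i _; rewrite /G normrM norm_conjC mulr_ile1 ?normr_ge0 //;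
    by rewrite /b; case: ifP => _; rewrite ?a1 // normr0 ler01.
  apply: le_trans (_ : \sum_(k' < K) B <= _); last by rewrite sumr_const card_ord mulr_natl.
  rewrite big_mkcond /=; apply: ler_sum => k' _; case: ifP => // kk'.
  case: (ltngtP k k') => [lt|lt|/val_inj eq]; last by rewrite eq eqxx in kk'.
    rewrite -norm_conjC rmorph_sum /=.
    under eq_bigr do rewrite rmorphM /= conjCK mulrC.
    exact: corr.
  exact: corr.
have := norm_sum_sqr (N + K) (fun n => \sum_(k < K) b (n + k)%N).
rewrite -KT normrM exprMn normr_nat => h.
have h2 := le_trans h (ler_wpM2l (ler0n _ _) bound).
rewrite -(ler_pM2l K0').
have -> : K%:R * (`|T| ^+ 2 * K%:R) = K%:R ^+ 2 * `|T| ^+ 2 by ring.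
apply: le_trans h2 _.
have -> : K%:R * (2%:R * N%:R * (N%:R + K%:R * B)) = (N%:R + N%:R) * (K%:R * (N%:R + K%:R * B)) by ring.
rewrite ler_wpM2r ?mulr_ge0 ?addr_ge0 ?mulr_ge0 ?ler0n //.
by rewrite natrD lerD2l ler_nat.
Qed.

End VanDerCorput.

Section Completion.
Variables (C : numClosedFieldType) (p : nat) (e : 'F_p -> C).
Hypotheses (p_pr : prime p) (e0 : e 0 = 1) (eD : forall x y, e (x + y) = e x * e y).
Hypotheses (e_norm : forall x, `|e x| = 1) (e_neq1 : forall z, z != 0 -> e z != 1).

Let eX x n : e (x * n%:R) = e x ^+ n.
Proof.
elim: n => [|n IHn]; first by rewrite mulr0 e0 expr0.
by rewrite -natr1 mulrDr mulr1 eD IHn exprSr.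
Qed.

Lemma addchar_orthogonality z : \sum_x e (x * z) = if z == 0 then p%:R else 0.
Proof.
case: eqP => [->|/eqP z0].
  by under eq_bigr do rewrite mulr0 e0; rewrite sumr_const cardT -cardE card_Fp.
have E : \sum_x e (x * z) = e z * \sum_x e (x * z).
  rewrite [LHS](reindex_inj (addrI 1)) /= mulr_sumr; apply: eq_bigr => x _.
  by rewrite mulrDl mul1r eD.
apply/eqP; have /eqP := E; rewrite -{1}[\sum_x _]mul1r -subr_eq0 -mulrBl mulf_eq0 subr_eq0.
by rewrite eq_sym (negPf (e_neq1 z0)).
Qed.

Lemma addchar_interval_sum a m m' : (m <= m')%N -> a != 0 ->
  `|\sum_(m <= n < m') e (a * n%:R)| <= 2%:R / `|1 - e a|.
Proof.
move=> mm a0; have d0 : 0 < `|1 - e a| by rewrite normr_gt0 subr_eq0 eq_sym e_neq1.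
rewrite ler_pdivlMr // -normrM mulr_suml.
rewrite (eq_bigr (fun n => - (e a ^+ n.+1 - e a ^+ n))) => [|n _]; last first.
  by rewrite opprB mulrBr mulr1 eX exprSr.
rewrite sumrN telescope_sumr // normrN (le_trans (ler_normB _ _)) // !normrX e_norm !expr1n.
by rewrite -natr1 lexx.
Qed.

(** The condition x = n is expanded by orthogonality. The zero frequency contributes at most m' - m
    <= p, and the others are geometric sums. *)
Lemma interval_sum_completion (F : 'F_p -> C) (W : C) m m' :
  (m <= m' <= p)%N -> (forall a, `|\sum_x F x * e (a * x)| <= W) ->
  p%:R * `|\sum_(m <= n < m') F n%:R| <= W * (p%:R + \sum_(a | a != 0) 2%:R / `|1 - e a|).
Proof.
move=> /andP[mm mp] FW.
have W0 : 0 <= W by apply: le_trans (FW 0).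
have E : p%:R * \sum_(m <= n < m') F n%:R =
    \sum_a (\sum_x F x * e (a * x)) * \sum_(m <= n < m') e (- a * n%:R).
  transitivity (\sum_(m <= n < m') \sum_x F x * \sum_a e (a * (x - n%:R))).
    rewrite mulr_sumr; apply: eq_bigr => n _.
    rewrite (bigD1 n%:R) //= addchar_orthogonality subrr eqxx mulrC big1 ?addr0 // => x xn.
    by rewrite addchar_orthogonality subr_eq0 (negPf xn) mulr0.
  under [RHS]eq_bigr do rewrite mulr_sumr.
  rewrite [RHS]exchange_big /=; apply: eq_bigr => n _.
  under eq_bigr do rewrite mulr_sumr.
  rewrite exchange_big /=; apply: eq_bigr => a _.
  rewrite mulr_suml; apply: eq_bigr => x _.
  by rewrite -mulrA -eD mulrBr mulNr.
rewrite -[X in X * _]normr_nat -normrM E (le_trans (ler_norm_sum _ _ _)) //.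
apply: le_trans (_ : \sum_a W * `|\sum_(m <= n < m') e (- a * n%:R)| <= _).
  by apply: ler_sum => a _; rewrite normrM ler_wpM2r.
rewrite -mulr_sumr ler_wpM2l // (reindex_inj oppr_inj) /=.
under eq_bigr do rewrite opprK.
rewrite (bigD1 0) //= lerD //.
  rewrite (le_trans (ler_norm_sum _ _ _)) //.
  under eq_bigr do rewrite mul0r e0 normr1.
  by rewrite sumr_const_nat ler_nat (leq_trans (leq_subr _ _)).
by apply: ler_sum => a a0; apply: addchar_interval_sum.
Qed.

End Completion.

(** * Explicit estimates behind the factor log p *)

Section RealEstimates.
Import numFieldNormedType.Exports.
Variable R : realType.
Implicit Types x y : R.

(** A weak form of Jordan's inequality: up to pi / 4 the cosine is at least 1/2, and beyond that
    monotonicity gives sin x >= pi / 8 >= x / 4. *)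
Lemma sin_ge_quarter x : 0 <= x <= pi / 2 -> x / 4 <= sin x.
Proof.
have pi2 : 2 <= pi :> R := pi_ge2 R.
have c4 : 1 / 2 <= cos (pi / 4) :> R.
  have c0 : 0 < cos (pi / 4) :> R by apply: cos_gt0_pihalf; apply/andP; split; lra.
  have : cos ((pi / 4) *+ 2) = 0 :> R.
    by rewrite (_ : (pi / 4) *+ 2 = pi / 2) ?cos_pihalf //; lra.
  rewrite cos_mulr2n => h; nra.
have small y : 0 <= y <= pi / 4 -> y / 2 <= sin y.
  move=> /andP[y0 y4]; have [->|yn] := eqVneq y 0; first by rewrite sin0 mul0r.
  have y_gt0 : 0 < y by rewrite lt_neqAle eq_sym yn.
  have [c] : exists2 c, c \in `]0, y[%R & sin y - sin 0 = cos c * (y - 0).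
    apply: MVT => //.
    by apply: continuous_subspaceT => z; apply: continuous_sin.
  rewrite in_itv /= sin0 !subr0 => /andP[c0 cy] ->.
  have : cos (pi / 4) < cos c.
    by rewrite ltr_cos ?in_itv /=; [lra|apply/andP; split; lra|apply/andP; split; lra].
  move=> h; nra.
move=> /andP[x0 x2]; have [xs|xl] := leP x (pi / 4).
  have := small x; rewrite x0 xs => /(_ isT); lra.
have h1 : sin (pi / 4) < sin x.
  by rewrite ltr_sin ?in_itv /=; [lra|apply/andP; split; lra|apply/andP; split; lra].
have := small (pi / 4); rewrite lexx andbT => /(_ _)h2.
have : pi / 4 / 2 <= sin (pi / 4) :> R by apply: h2; lra.
lra.
Qed.

Lemma ln_ge1Bv x : 0 < x -> 1 - x^-1 <= ln x.
Proof.
move=> x0; have := @le_ln1Dx R (x^-1 - 1).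
rewrite (_ : 1 + (x^-1 - 1) = x^-1); last lra.
rewrite lnV ?posrE //.
have xv : 0 < x^-1 by rewrite invr_gt0.
move=> /(_ _)h; have : - ln x <= x^-1 - 1 by apply: h; lra.
lra.
Qed.

Lemma harmonic_le_ln n : (0 < n)%N -> \sum_(1 <= k < n.+1) (k%:R)^-1 <= 1 + ln n%:R :> R.
Proof.
case: n => // n _; elim: n => [|n IHn]; first by rewrite big_nat1 invr1 ln1 addr0.
rewrite big_nat_recr //= (le_trans (lerD IHn (lexx _))) // -addrA lerD2l.
have n1 : 0 < n.+1%:R :> R by rewrite ltr0n.
have n2 : 0 < n.+2%:R :> R by rewrite ltr0n.
have := @ln_ge1Bv (n.+2%:R / n.+1%:R) (divr_gt0 n2 n1).
rewrite ln_div ?posrE // invf_div => h.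
have E : 1 - n.+1%:R / n.+2%:R = (n.+2%:R)^-1 :> R.
  apply: (mulIf (lt0r_neq0 n2)); rewrite mulrBl mul1r !mulVf ?divfK ?lt0r_neq0 //.
  by rewrite -[n.+2%:R]natr1 addrAC subrr add0r.
by move: h; rewrite E lerBrDl.
Qed.

Lemma ln_ge_half p : (2 < p)%N -> 1 / 2 <= ln p%:R :> R.
Proof.
move=> p2; have p0 : 0 < p%:R :> R by rewrite ltr0n; lia.
apply: le_trans (ln_ge1Bv p0).
have : (p%:R)^-1 <= 3^-1 :> R by rewrite lef_pV2 ?posrE ?ler_nat // ltr0n.
lra.
Qed.

End RealEstimates.

Section Characters.
Variables (R : realType) (p : nat).
Hypothesis p_pr : prime p.
Local Notation C := R[i].
Local Notation psi := (@add_char R p).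

Let p_gt0 : 0 < p%:R :> R. Proof. by rewrite ltr0n prime_gt0. Qed.

Let circ (n : nat) : C := cos (2 * pi * n%:R / p%:R) +i* sin (2 * pi * n%:R / p%:R).

Let circD m n : circ (m + n) = circ m * circ n.
Proof.
rewrite /circ natrD mulrDr mulrDl cosD sinD; apply/eqP.
by rewrite eq_complex /= eqxx addrC eqxx.
Qed.

Let circ_mod m : circ (m %% p) = circ m.
Proof.
have cp : circ p = 1.
  rewrite /circ mulfK ?gt_eqF // [2 * pi]mulr_natl.
  by rewrite cos2pi sin2pi.
have cq q : circ (q * p) = 1.
  elim: q => [|q IHq]; last by rewrite mulSn circD cp mul1r.
  by rewrite /circ mul0n mulr0 mul0r cos0 sin0.
by rewrite [in RHS](divn_eq m p) circD cq mul1r.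
Qed.

Lemma add_charE z : psi z = circ z. Proof. by []. Qed.

Lemma add_char0 : psi 0 = 1.
Proof. by rewrite add_charE /circ mulr0 mul0r cos0 sin0. Qed.

Lemma add_charD x y : psi (x + y) = psi x * psi y.
Proof. by rewrite !add_charE -circD -[RHS]circ_mod /= [X in circ (_ %% X)]Fp_cast. Qed.

Lemma add_char_norm z : `|psi z| = 1.
Proof. by rewrite normc_def /= cos2Dsin2 sqrtr1. Qed.

(** |1 - e(k)| = 2 sin(pi k / p) is at least min(k, p - k) / p. Bounding the inverse of the minimum
    by the sum of both inverses reduces the sum over k to two equal harmonic sums. *)
Lemma add_char_dist z : z != 0 ->
  2%:R / `|1 - psi z| <= (2 * p%:R / (nat_of_ord z)%:R + 2 * p%:R / (p%:R - (nat_of_ord z)%:R))%:C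
  /\ psi z != 1.
Proof.
move=> z0; set k : nat := z.
have kp : (k < p)%N by have := ltn_ord z; rewrite [X in (_ < X)%N -> _]Fp_cast.
have k0 : (0 < k)%N by rewrite lt0n.
have pi2 : 2 <= pi :> R := pi_ge2 R.
have k0' : 0 < k%:R :> R by rewrite ltr0n.
have kp' : k%:R < p%:R :> R by rewrite ltr_nat.
set t : R := pi * k%:R / p%:R.
have t_low (x : R) : 0 < x <= p%:R / 2 -> x / (2 * p%:R) <= sin (pi * x / p%:R).
  move=> /andP[x0 x2]; have := @sin_ge_quarter R (pi * x / p%:R).
  have pp : 0 < pi :> R by lra.
  have -> : 0 <= pi * x / p%:R <= pi / 2.
    rewrite divr_ge0 ?mulr_ge0 ?(ltW pp) ?(ltW x0) ?(ltW p_gt0) //=.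
    by rewrite ler_pdivrMr // -mulrA ler_pM2l // mulrC.
  move=> /(_ isT); apply: le_trans.
  have -> : x / (2 * p%:R) = x / p%:R / 2 by field; rewrite gt_eqF.
  have : 0 <= x / p%:R by rewrite divr_ge0 ?(ltW x0) ?(ltW p_gt0).
  by rewrite -[pi * x / _]mulrA; move: (x / p%:R) => y y0; nra.
have sin_low : Num.min k%:R (p%:R - k%:R) / (2 * p%:R) <= sin t.
  have [le|lt] := leP k%:R (p%:R / 2 : R).
    rewrite min_l; last lra.
    by apply: t_low; rewrite k0' le.
  rewrite min_r; last lra.
  have -> : sin t = sin (pi * (p%:R - k%:R) / p%:R).
    have -> : pi * (p%:R - k%:R) / p%:R = pi - t.
      by rewrite /t; field; rewrite gt_eqF.
    by rewrite sinB sinpi cospi mul0r sub0r mulN1r opprK.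
  by apply: t_low; apply/andP; split; lra.
set mn := Num.min _ _ in sin_low.
have mn0 : 0 < mn by rewrite lt_min k0' subr_gt0.
have s0 : 0 < sin t by apply: lt_le_trans sin_low; rewrite divr_gt0 // mulr_gt0.
have nE : `|1 - psi z| = (2 * sin t)%:C.
  rewrite add_charE /circ normc_def /=; congr (_%:C).
  have -> : 2 * pi * k%:R / p%:R = t *+ 2 by rewrite /t -mulr_natl; ring.
  rewrite -[RHS]ger0_norm ?mulr_ge0 ?(ltW s0) // -sqrtr_sqr; congr Num.sqrt.
  have := cos2Dsin2 t; rewrite cos_mulr2n sin_mulr2n.
  move: (cos t) (sin t) => c s cs.
  have -> : c ^+ 2 = 1 - s ^+ 2 by rewrite -cs addrK.
  have -> : (0 - (c * s) *+ 2) ^+ 2 = 4 * (c ^+ 2 * s ^+ 2) by ring.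
  have -> : c ^+ 2 = 1 - s ^+ 2 by rewrite -cs addrK.
  by ring.
split; last first.
  apply: contraTneq isT => e1; move: nE; rewrite e1 subrr normr0 => /eqP.
  by rewrite eq_complex /= eq_sym mulf_eq0 (gt_eqF s0) orbF pnatr_eq0.
rewrite nE.
have -> : 2%:R / (2 * sin t)%:C = (2 / (2 * sin t))%:C :> C.
  by rewrite [RHS]rmorphM /= fmorphV rmorph_nat.
rewrite lecR.
apply: le_trans (_ : 2 * p%:R / mn <= _).
  rewrite ler_pdivrMr ?mulr_gt0 // mulrAC ler_pdivlMr //.
  by move: sin_low; rewrite ler_pdivrMr ?mulr_gt0 //; nra.
rewrite /mn; case: (leP k%:R (p%:R - k%:R)) => _.
  by rewrite lerDl divr_ge0 // ?mulr_ge0 ?ltW // subr_gt0.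
by rewrite lerDr divr_ge0 // ?mulr_ge0 ?ltW.
Qed.

End Characters.

Lemma complex_archimedean (R : realType) (x : R[i]) : 0 <= x -> exists n : nat, x < n%:R.
Proof.
move=> x0; have xr : x = (complex.Re x)%:C by rewrite RRe_real ?ger0_real.
have r0 : 0 <= complex.Re x by rewrite -ler0c -xr.
exists (Num.bound (complex.Re x)); rewrite xr -(rmorph_nat (real_complex R)) ltcR.
exact: archi_boundP.
Qed.

Lemma sqrtC_nat (R : realType) (n : nat) : sqrtC n%:R = (Num.sqrt n%:R)%:C :> R[i].
Proof.
rewrite -[RHS]sqrCK ?ler0c ?sqrtr_ge0 // -rmorphXn /= sqr_sqrtr ?ler0n //.
by rewrite rmorph_nat.
Qed.

Section IncompleteSums.
Variables (R : realType) (p : nat) (chi : {unit 'F_p} -> R[i]).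
Hypotheses (p_pr : prime p) (p_gt2 : (2 < p)%N).
Hypotheses (chiP : mult_char chi) (chi_np : chi <> @principal_char R p).
Local Notation psi := (@add_char R p).

Lemma add_char_sum_dist :
  \sum_(a : 'F_p | a != 0) 2%:R / `|1 - psi a| <= (4 * p%:R * (1 + ln p%:R))%:C.
Proof.
have p0 : 0 < p%:R :> R by rewrite ltr0n prime_gt0.
pose G k : R := 2 * p%:R / k%:R + 2 * p%:R / (p%:R - k%:R).
apply: le_trans (_ : (\sum_(1 <= k < p) G k)%:C <= _).
  have -> : \sum_(1 <= k < p) G k = \sum_(a : 'F_p | a != 0) G a.
    transitivity (\sum_(0 <= k < p | k != 0%N) G k).
      rewrite [RHS]big_ltn_cond ?prime_gt0 //= [LHS]big_nat_cond [RHS]big_nat_cond.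
      by apply: eq_bigl => k; case: k.
    rewrite -{1}(Fp_cast p_pr) (big_mkord (fun k => k != 0%N)).
    by apply: eq_bigl => a.
  rewrite rmorph_sum /=; apply: ler_sum => a a0.
  by have [] := add_char_dist R p_pr a0.
rewrite lecR; set S := \sum_(1 <= k < p) (k%:R)^-1 : R.
have SE : \sum_(1 <= k < p) G k = 4 * p%:R * S.
  rewrite /G big_split /= -!mulr_sumr -/S.
  rewrite [X in _ + _ * X]big_nat_rev /= [X in _ + _ * X](_ : _ = S); first by ring.
  apply: eq_big_nat => k /andP[k1 kp]; congr (_^-1).
  by rewrite add1n subSS natrB ?(ltnW kp) // opprB addrC subrK.
have SB : S <= 1 + ln p%:R.
  apply: le_trans (harmonic_le_ln R (prime_gt0 p_pr)).
  by rewrite [X in _ <= X]big_nat_recr ?prime_gt0 //= lerDl invr_ge0 ler0n.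
by rewrite SE ler_pM2l // mulr_gt0.
Qed.

Definition chi_ext (z : 'F_p) : R[i] := if z == 0 then 0 else chi (insubd (1%g : {unit 'F_p}) z).

Lemma chi_ext_val (u : {unit 'F_p}) : chi_ext (val u) = chi u.
Proof.
have u0 : val u != 0 by rewrite -unitfE; apply: (valP u).
rewrite /chi_ext (negPf u0); congr chi; apply: val_inj.
by rewrite insubdK //; apply: (valP u).
Qed.

Let chi_ext_unit (z : 'F_p) : z != 0 -> exists u : {unit 'F_p}, z = val u.
Proof.
move=> z0; exists (insubd (1%g : {unit 'F_p}) z); rewrite insubdK //.
by rewrite -topredE /= unitfE.
Qed.

Lemma chi_ext0 : chi_ext 0 = 0. Proof. by rewrite /chi_ext eqxx. Qed.

Lemma chi_ext1 : chi_ext 1 = 1.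
Proof. by have [c1 _] := chiP; rewrite -c1 -chi_ext_val. Qed.

Lemma chi_extM x y : chi_ext (x * y) = chi_ext x * chi_ext y.
Proof.
have [->|/chi_ext_unit[u ->]] := eqVneq x 0; first by rewrite mul0r chi_ext0 mul0r.
have [->|/chi_ext_unit[v ->]] := eqVneq y 0; first by rewrite mulr0 chi_ext0 mulr0.
by have [_ cM] := chiP; rewrite -[_ * val v]/(val (u * v)%g) !chi_ext_val.
Qed.

Lemma chi_ext_norm x : x != 0 -> `|chi_ext x| = 1.
Proof.
move=> x0; have chiX n : chi_ext (x ^+ n) = chi_ext x ^+ n.
  by elim: n => [|n IHn]; rewrite ?chi_ext1 // !exprS chi_extM IHn.
have : chi_ext x ^+ p = chi_ext x.
  by rewrite -chiX; have := expf_card x; rewrite card_Fp // => ->.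
have [xi xiE] : exists y, chi_ext x * y = 1.
  by exists (chi_ext x^-1); rewrite -chi_extM divff // chi_ext1.
move=> E; have E1 : chi_ext x ^+ p.-1 = 1.
  by rewrite -[LHS]mulr1 -[X in _ * X]xiE mulrA -exprSr prednK ?prime_gt0 // E.
apply/eqP; rewrite -(@pexpr_eq1 _ _ p.-1) ?normr_ge0 // -?normrX ?E1 ?normr1 //.
by rewrite -ltnS prednK ?prime_gt0 // ltnW.
Qed.

Lemma chi_ext_norm_le x : `|chi_ext x| <= 1.
Proof.
have [->|x0] := eqVneq x 0; last by rewrite chi_ext_norm.
by rewrite chi_ext0 normr0 ler01.
Qed.

Lemma chi_ext_nontrivial : exists2 u : 'F_p, u != 0 & chi_ext u != 1.
Proof.
have [[u /eqP u1]|nex] := pselect (exists u, chi u <> 1).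
  by exists (val u); [rewrite -unitfE; apply: (valP u) | rewrite chi_ext_val].
case: chi_np; apply/funext => u; apply: contrapT => u1.
by apply: nex; exists u.
Qed.

(** Completion twists by psi (a x), which is absorbed into g; the degree may rise to d + 1, hence
    the factor K + d + 1 and the condition d + 1 < p. *)
Lemma incomplete_mixed_sum (K d m m' : nat) (g : {poly 'F_p}) :
  (0 < K <= p)%N -> (d.+1 < p)%N -> (size g <= d.+1)%N -> (m <= m' <= p)%N ->
  `|\sum_(m <= n < m') chi_ext (\prod_(i < K) (n%:R + i%:R)) * psi g.[n%:R]| <=
    (14 * (K + d.+1)%:R * (Num.sqrt p%:R * ln p%:R))%:C.
Proof.
move=> Kp dp sg mm.
have p0 : 0 < p%:R :> R by rewrite ltr0n prime_gt0.
have [u u0 chiu] := chi_ext_nontrivial.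
pose F (x : 'F_p) := chi_ext (\prod_(i < K) (x + i%:R)) * psi g.[x].
have W a : `|\sum_x F x * psi (a * x)| <= ((K + d.+1)%:R * Num.sqrt p%:R)%:C.
  have sga : (size (g + a *: 'X)%R <= d.+2)%N.
    rewrite (leq_trans (size_polyD _ _)) // geq_max (leq_trans sg) //=.
    by rewrite (leq_trans (size_scale_leq _ _)) // size_polyX.
  have := @weil_mixed_sum R[i] p K d.+1 (g + a *: 'X) chi_ext psi u
    (@complex_archimedean R) p_pr p_gt2 Kp dp sga chi_ext1 chi_extM chi_ext0 u0 chiu
    (add_char0 R p) (add_charD R p_pr) chi_ext_norm_le (fun x => _).
  rewrite sqrtC_nat -(rmorph_nat (real_complex R)) -rmorphM /=.
  move=> /(_ _) h; rewrite (eq_bigr (fun x => chi_ext (\prod_(i < K) (x + i%:R)) * psi (g + a *: 'X).[x])).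
    by apply: h => x; rewrite add_char_norm.
  by move=> x _; rewrite /F -mulrA hornerD hornerZ hornerX add_charD.
have := interval_sum_completion p_pr (add_char0 R p) (add_charD R p_pr) (@add_char_norm R p)
  (fun z z0 => (add_char_dist R p_pr z0).2) mm W.
set T := \sum_(m <= n < m') _.
rewrite -[X in X * _ <= _](rmorph_nat (real_complex R)) => h.
rewrite -(@ler_pM2l _ (p%:R)%:C) ?ltcR // (le_trans h) //.
apply: le_trans (_ : ((K + d.+1)%:R * Num.sqrt p%:R)%:C * (p%:R + 4 * p%:R * (1 + ln p%:R))%:C <= _).
  rewrite ler_wpM2l ?ler0c ?mulr_ge0 ?sqrtr_ge0 ?ler0n // [in leRHS]rmorphD /= rmorph_nat.
  by rewrite lerD2l add_char_sum_dist.
rewrite -!rmorphM /= lecR.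
(* The constant 14: p + 4 p (1 + ln p) = p (5 + 4 ln p), and 5 <= 10 ln p. *)
have L := ln_ge_half R p_gt2.
have q0 := sqrtr_ge0 (p%:R : R).
have k0 : 0 <= (K + d.+1)%:R :> R by rewrite ler0n.
rewrite [X in _ <= X](_ : _ = (K + d.+1)%:R * Num.sqrt p%:R * (p%:R * (14 * ln p%:R))); last by ring.
rewrite ler_wpM2l ?mulr_ge0 //.
rewrite (_ : p%:R + _ = p%:R * (5 + 4 * ln p%:R)); last by ring.
by rewrite ler_pM2l //; lra.
Qed.

End IncompleteSums.

Section FactorialSum.
Variables (R : realType) (p d : nat) (chi : {unit 'F_p} -> R[i]).
Hypotheses (p_pr : prime p) (p_gt2 : (2 < p)%N) (d_lt : (d.+1 < p)%N).
Hypotheses (chiP : mult_char chi) (chi_np : chi <> @principal_char R p).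
Variable f : {poly 'F_p}.
Hypothesis sf : (size f <= d.+1)%N.
Local Notation psi := (@add_char R p).

Lemma chi_unit_fact n : (n < p)%N -> chi (unit_fact p n) = chi_ext chi n`!%:R.
Proof. by move=> np; rewrite -(val_unit_fact p_pr np) chi_ext_val. Qed.

Lemma fact_natr_neq0 n : (n < p)%N -> n`!%:R != 0 :> 'F_p.
Proof.
move=> np; have : val (unit_fact p n) != 0 by rewrite -unitfE; apply: (valP (unit_fact p n)).
by rewrite (val_unit_fact p_pr np).
Qed.

Lemma fact_correlation n j : (n + j < p)%N ->
  chi (unit_fact p (n + j)) * psi f.[(n + j)%:R] * (chi (unit_fact p n) * psi f.[n%:R])^* =
  chi_ext chi (\prod_(i < j) (n.+1%:R + i%:R)) * psi (f.[(n + j)%:R] - f.[n%:R]).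
Proof.
move=> njp; have np : (n < p)%N by apply: leq_ltn_trans njp; apply: leq_addr.
rewrite !chi_unit_fact // rmorphM /= mulrACA; congr (_ * _).
  have -> : (n + j)`!%:R = n`!%:R * \prod_(i < j) (n.+1%:R + i%:R) :> 'F_p.
    elim: j {njp} => [|j IHj]; first by rewrite addn0 big_ord0 mulr1.
    by rewrite addnS factS natrM IHj big_ord_recr /= -natrD addSn mulrC -mulrA.
  rewrite (chi_extM chiP) mulrAC -normCK (chi_ext_norm p_pr p_gt2 chiP) ?fact_natr_neq0 //.
  by rewrite expr1n mul1r.
rewrite -{1}[f.[(n + j)%:R]](subrK f.[n%:R]) add_charD // -mulrA -normCK.
by rewrite add_char_norm expr1n mulr1.
Qed.

Lemma fact_sum_correlation H M j : (0 < j)%N -> (H.+1 + M + j <= p)%N ->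
  `|\sum_(i < M) (chi (unit_fact p (H.+1 + (i + j))) * psi f.[(H.+1 + (i + j))%:R]) *
     (chi (unit_fact p (H.+1 + i)) * psi f.[(H.+1 + i)%:R])^*| <=
  (14 * (j + d.+1)%:R * (Num.sqrt p%:R * ln p%:R))%:C.
Proof.
move=> j0 HMj.
(* The variable is n + 1, the first factor of (n + j)! / n!; hence the arguments X + (j - 1) and X -
   1 for n + j and n. *)
pose g := (f \Po ('X + (j.-1%:R)%:P)) - (f \Po ('X - 1%:P)).
have sg : (size g <= d.+1)%N.
  have s1 (c : 'F_p) : size ('X + c%:P) = 2 by apply: size_XaddC.
  apply: leq_trans (size_polyD _ _) _; rewrite geq_max size_polyN.
  by rewrite -polyCN !size_comp_poly2 ?s1 // sf.
have jp : (0 < j <= p)%N by rewrite j0 (leq_trans _ HMj) // leq_addl.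
have mm : (H.+2 <= H.+2 + M <= p)%N by rewrite leq_addr /= (leq_trans _ HMj) //; lia.
have := incomplete_mixed_sum p_pr p_gt2 chiP chi_np jp d_lt sg mm.
apply: le_trans; rewrite le_eqVlt; apply/orP; left; apply/eqP; congr `|_|.
rewrite -{1}[H.+2]add0n big_addn addKn big_mkord; apply: eq_bigr => i _.
have iM := ltn_ord i.
rewrite addnA fact_correlation; last by lia.
have -> : (H.+1 + i).+1 = (i + H.+2)%N by lia.
congr (_ * psi _).
rewrite /g hornerD hornerN !horner_comp !hornerE.
congr (f.[_] - f.[_]).
  by rewrite -natrD; congr (_%:R); lia.
have -> : (i + H.+2)%N = (H.+1 + i).+1 by lia.
by rewrite -[(H.+1 + i).+1%:R]natr1 addrK.
Qed.

Lemma fact_sum_van_der_corput H N K : (H < H + N < p)%N -> (0 < K <= N)%N ->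
  `|fact_sum chi f H N| ^+ 2 * K%:R <=
  (2 * N%:R * (N%:R + K%:R * (14 * (K + d.+1)%:R * (Num.sqrt p%:R * ln p%:R))))%:C.
Proof.
move=> HN KN.
pose a i := chi (unit_fact p (H.+1 + i)) * psi f.[(H.+1 + i)%:R].
have TE : fact_sum chi f H N = \sum_(i < N) a i.
  rewrite /fact_sum -{1}[H.+1]add0n big_addn subSS addKn big_mkord.
  by apply: eq_bigr => i _; rewrite /a addnC.
have L := ln_ge_half R p_gt2.
pose B : R := 14 * (K + d.+1)%:R * (Num.sqrt p%:R * ln p%:R).
have q0 : 0 <= Num.sqrt p%:R * ln p%:R :> R by rewrite mulr_ge0 ?sqrtr_ge0 //; lra.
have B0 : 0 <= B%:C :> R[i] by rewrite ler0c /B mulr_ge0 // mulr_ge0 ?ler0n.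
have a1 n : `|a n| <= 1.
  rewrite /a normrM add_char_norm mulr1.
  by rewrite -chi_ext_val (chi_ext_norm_le p_pr p_gt2 chiP).
have corr j : (0 < j < K)%N -> `|\sum_(i < N - j) a (i + j)%N * (a i)^*| <= B%:C.
  move=> /andP[j0 jK]; have HNj : (H.+1 + (N - j) + j <= p)%N by lia.
  apply: le_trans (fact_sum_correlation j0 HNj) _.
  rewrite lecR ler_wpM2r // ler_wpM2l // ler_nat leq_add2r ltnW //.
have := van_der_corput KN B0 a1 corr; rewrite -TE => /le_trans; apply.
rewrite -/B -!(rmorph_nat (real_complex R)) -[K%:R%:C * _]rmorphM -[_ + _ in leLHS]rmorphD.
by rewrite -!rmorphM.
Qed.

End FactorialSum.

Lemma optimize_shift (R : realType) (d N : nat) (tau s L : R) :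
  (0 < N)%N -> 0 <= tau <= N%:R -> 1 <= s -> 1 / 2 <= L ->
  (forall K : nat, (0 < K <= N)%N ->
     tau ^+ 2 * K%:R <= 2 * N%:R * (N%:R + K%:R * (14 * (K + d.+1)%:R * (s * L)))) ->
  tau ^+ 4 <= 8 * (14 * d%:R + 30) ^+ 2 * (N%:R ^+ 3 * (s * L)).
Proof.
move=> N0 /andP[t0 tN] s1 L1 hK; set M := 2 * (s * L).
have n1 : 1 <= N%:R :> R by rewrite ler1n.
have d0 : 0 <= d%:R :> R by rewrite ler0n.
have M1 : 1 <= M by rewrite /M; nra.
have sL : s * L = M / 2 by rewrite /M; field.
(* For N < M the trivial bound tau <= N is enough: N^4 <= N^3 M. *)
rewrite sL; have [NM|MN] := ltP N%:R M.
  have t4 : tau ^+ 4 <= N%:R ^+ 4 by rewrite lerXn2r ?nnegrE // (le_trans t0 tN).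
  apply: le_trans t4 _; rewrite exprSr.
  have n3 : 0 <= N%:R ^+ 3 :> R by rewrite exprn_ge0.
  have E1 : 1 <= (14 * d%:R + 30) ^+ 2 :> R by nra.
  rewrite (_ : 8 * _ * _ = N%:R ^+ 3 * (4 * (14 * d%:R + 30) ^+ 2 * M)); last by field.
  by rewrite ler_wpM2l //; move: ((14 * d%:R + 30) ^+ 2) E1 => E E1; nra.
have M0 : 0 < M by lra.
(* K is the integer part of sqrt (N / M), which balances N against K^2 M. From K <= x < 2 K one gets
   K^2 M <= N <= 4 K^2 M, whence the factor 8 = 4 * 2 in the result. *)
pose x := Num.sqrt (N%:R / M); have NM0 : 0 <= N%:R / M by rewrite divr_ge0 //; lra.
have x0 : 0 <= x by apply: sqrtr_ge0.
have x2 : x ^+ 2 = N%:R / M by apply: sqr_sqrtr.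
have x1 : 1 <= x by rewrite -sqrtr1 ler_sqrt // ler_pdivlMr // mul1r.
pose K := Num.truncn x; have /andP[Kx xK] := truncn_itv x0.
rewrite -/K in Kx xK.
have K0 : (0 < K)%N by rewrite truncn_gt0.
have k1 : 1 <= K%:R :> R by rewrite ler1n.
have K2 : K%:R ^+ 2 * M <= N%:R.
  by rewrite -ler_pdivlMr // -x2 lerXn2r ?nnegrE ?ler0n.
have KN : (K <= N)%N by rewrite -(ler_nat R); nra.
have N4 : N%:R <= 4 * (K%:R ^+ 2 * M).
  have : x <= 2 * K%:R by rewrite (le_trans (ltW xK)) // -natr1; lra.
  move=> h; have : x ^+ 2 <= 4 * K%:R ^+ 2 by nra.
  by rewrite x2 ler_pdivrMr // mulrA.
have := hK K; rewrite K0 KN sL => /(_ isT) h.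
(* The constant is 14 d + 30 = 2 (1 + 7 (d + 2)), using K + d + 1 <= (d + 2) K. *)
have hE : tau ^+ 2 * K%:R <= (14 * d%:R + 30) * N%:R ^+ 2.
  apply: le_trans h _.
  have : K%:R * (14 * (K + d.+1)%:R * (M / 2)) <= 7 * (d%:R + 2) * (K%:R ^+ 2 * M).
    have : (K + d.+1)%:R <= (d%:R + 2) * K%:R :> R by rewrite natrD -natr1; nra.
    move=> h2; rewrite (_ : K%:R * _ = 7 * (K%:R * M) * (K + d.+1)%:R); last by field.
    rewrite (_ : 7 * (d%:R + 2) * _ = 7 * (K%:R * M) * ((d%:R + 2) * K%:R)); last by ring.
    by rewrite ler_wpM2l //; nra.
  move=> h2; have : K%:R * (14 * (K + d.+1)%:R * (M / 2)) <= 7 * (d%:R + 2) * N%:R.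
    by apply: le_trans h2 _; rewrite ler_wpM2l //; lra.
  move=> h3; nra.
have h4 : tau ^+ 4 * K%:R ^+ 2 <= (14 * d%:R + 30) ^+ 2 * N%:R ^+ 4.
  rewrite (_ : tau ^+ 4 * _ = (tau ^+ 2 * K%:R) ^+ 2); last by ring.
  rewrite (_ : _ * N%:R ^+ 4 = ((14 * d%:R + 30) * N%:R ^+ 2) ^+ 2); last by ring.
  by rewrite lerXn2r ?nnegrE ?mulr_ge0 ?exprn_ge0 //; lra.
have nN : 0 < N%:R :> R by lra.
rewrite -(ler_pM2r nN).
apply: le_trans (_ : tau ^+ 4 * (4 * (K%:R ^+ 2 * M)) <= _).
  by rewrite ler_wpM2l // exprn_ge0.
rewrite (_ : tau ^+ 4 * _ = 4 * M * (tau ^+ 4 * K%:R ^+ 2)); last by ring.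
rewrite (_ : _ * N%:R = 4 * M * ((14 * d%:R + 30) ^+ 2 * N%:R ^+ 4)); last by field.
by rewrite ler_wpM2l //; lra.
Qed.

Lemma powR_quartic (R : realType) (n q l : R) : 0 <= n -> 0 <= q -> 0 <= l ->
  (n `^ (3 / 4) * q `^ (1 / 8) * l `^ (1 / 4)) ^+ 4 = n ^+ 3 * (Num.sqrt q * l).
Proof.
move=> n0 q0 l0; rewrite !exprMn -mulrA -!powR_mulrn ?powR_ge0 // -!powRrM.
congr (_ * (_ * _)).
- by congr (_ `^ _); field.
- by rewrite (_ : 1 / 8 * 4%:R = 2^-1) ?powR12_sqrt //; field.
- by rewrite (_ : 1 / 4 * 4%:R = 1) ?powRr1 //; field.
Qed.

Theorem theorem1 (R : realType) (d : nat) :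
  exists C : R, 0 < C /\
    forall (p H N : nat), prime p -> odd p -> (H < H + N < p)%N ->
    forall f : {poly 'F_p}, size f = d.+1 ->
    forall chi : {unit 'F_p} -> R[i],
      mult_char chi -> chi <> @principal_char R p ->
      `|fact_sum chi f H N| <=
        (C * (N%:R `^ (3 / 4) * p%:R `^ (1 / 8) * (ln p%:R) `^ (1 / 4)))%:C.
Proof.
pose C0 : R := 8 * (14 * d%:R + 30) ^+ 2.
have d0 : 0 <= d%:R :> R by rewrite ler0n.
have C1 : 1 <= C0 by rewrite /C0; nra.
exists C0; split; first by lra.
move=> p H N p_pr p_odd HN f sf chi chiP chi_np.
have p2 : (2 < p)%N by apply: odd_prime_gt2.
have N0 : (0 < N)%N by lia.
pose tau := complex.Re `|fact_sum chi f H N|.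
have tauE : `|fact_sum chi f H N| = tau%:C by rewrite /tau RRe_real ?normr_real.
have t0 : 0 <= tau by rewrite -ler0c -tauE normr_ge0.
have tN : tau <= N%:R.
  rewrite -lecR -tauE rmorph_nat /fact_sum (le_trans (ler_norm_sum _ _ _)) //.
  apply: le_trans (_ : \sum_(H.+1 <= n < (H + N).+1) 1 <= _).
    apply: ler_sum => n _; rewrite normrM add_char_norm mulr1.
    by rewrite -chi_ext_val (chi_ext_norm_le p_pr p2 chiP).
  by rewrite sumr_const_nat subSS addKn.
have L1 := ln_ge_half R p2.
have s2 : Num.sqrt p%:R ^+ 2 = p%:R :> R by rewrite sqr_sqrtr.
have s1 : 1 <= Num.sqrt p%:R :> R by rewrite -[leLHS]sqrtr1 ler_sqrt // ler1n prime_gt0.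
(* On fourth powers the exponents 3/4, 1/8 and 1/4 become 3, 1/2 and 1. *)
have quartic : tau ^+ 4 <= C0 * (N%:R ^+ 3 * (Num.sqrt p%:R * ln p%:R)).
  have [dp|pd] := ltnP d.+1 p.
    apply: optimize_shift => // [|K KN]; first by rewrite t0.
    have := fact_sum_van_der_corput p_pr p2 dp chiP chi_np (eq_leq sf) HN KN.
    by rewrite tauE -(rmorph_nat (real_complex R)) -rmorphXn -rmorphM /= lecR.
  (* Here p <= d + 1, so N < p is bounded in terms of d and the constant absorbs the trivial
     bound. *)
  have t4 : tau ^+ 4 <= N%:R ^+ 4 by rewrite lerXn2r ?nnegrE // (le_trans t0 tN).
  apply: le_trans t4 _; rewrite exprSr.
  have n3 : 0 <= N%:R ^+ 3 :> R by rewrite exprn_ge0.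
  have np : N%:R <= p%:R :> R by rewrite ler_nat; lia.
  have pd' : p%:R <= d%:R + 1 :> R by rewrite natr1 ler_nat.
  rewrite mulrCA ler_wpM2l // (le_trans np) // mulrCA.
  have sp : Num.sqrt p%:R <= p%:R :> R by rewrite -[leRHS]s2 expr2 ler_peMl //; lra.
  rewrite -[leLHS]s2 expr2 ler_wpM2l; [by []|lra|].
  apply: le_trans (le_trans sp pd') _.
  have : C0 * (1 / 2) <= C0 * ln p%:R by rewrite ler_wpM2l //; lra.
  rewrite {1}/C0 => h; nra.
rewrite tauE lecR.
set Y := _ * _ * _.
have Y0 : 0 <= Y by rewrite !mulr_ge0 ?powR_ge0.
have YE : Y ^+ 4 = N%:R ^+ 3 * (Num.sqrt p%:R * ln p%:R) by apply: powR_quartic => //; lra.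
rewrite -(@ler_pXn2r _ 4) ?nnegrE //; last by rewrite mulr_ge0 //; lra.
apply: le_trans quartic _; rewrite -YE [leRHS]exprMn ler_wpM2r ?exprn_ge0 //.
(* C0 >= 1 gives C0 <= C0^4, which avoids a fourth root in the constant. *)
by rewrite -[leLHS]expr1 ler_weXn2l.
Qed.
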